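(* Let $a>0$, $y\in\mathbb{C}$, $q\in(0,1)\cup\mathbb{N}$, and let $\delta,\lambda,\mu,v,\gamma\in\mathbb{C}$ satisfy $\Re(\delta)\ge 0$, $\Re(v)>-1$, $\Re(\gamma)\ge 0$, $\gamma\neq 0$, $\Re(\delta)-q>-1$ and $0<\Re(\mu)<\Re(\lambda)$. Then $$\int_{0}^{\infty }x^{\mu -1}\left( x+a+\sqrt{x^{2}+2ax}\right)^{-\lambda } J_{v,q}^{\delta ,\gamma }\left( \frac{xy}{x+a+\sqrt{x^{2}+2ax}}\right) dx = 2^{1-\mu}a^{\mu-\lambda}\,\frac{\Gamma(\lambda-\mu)}{\Gamma(\gamma)}\; {}_{3}\Psi_{3}\left[ \begin{array}{c} (\gamma ,q),\ (\lambda +1,1),\ (2\mu,2); \\ (v+1,\delta),\ (1+\lambda+\mu ,2),\ (\lambda ,1); \end{array} -\frac{y}{2}\right].$$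
   Context: The generalized Bessel-Maitland function is defined by $J_{v,q}^{\delta,\gamma}(z)=\sum_{n=0}^{\infty}\frac{(\gamma)_{qn}(-z)^n}{n!\,\Gamma(\delta n+v+1)}$, where $(\gamma)_0=1$ and $(\gamma)_{qn}=\frac{\Gamma(\gamma+qn)}{\Gamma(\gamma)}$. The generalized Wright hypergeometric function is the series ${}_{p}\Psi_{r}\left[\begin{array}{c}(a_1,\alpha_1),\dots,(a_p,\alpha_p);\\ (b_1,\beta_1),\dots,(b_r,\beta_r);\end{array} z\right]=\sum_{k=0}^{\infty}\frac{\prod_{i=1}^{p}\Gamma(a_i+\alpha_i k)}{\prod_{j=1}^{r}\Gamma(b_j+\beta_j k)}\frac{z^k}{k!}$. Here $1/\Gamma$ is the entire reciprocal Gamma function, and powers of positive reals with complex exponents are the principal ones. *)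

(* Defs.v *)
From Stdlib Require Export Reals Factorial List.
From Coquelicot Require Export Coquelicot.
Export ListNotations.

#[global] Open Scope C_scope.

(** Limits and sums of complex sequences are taken componentwise; like
    [Lim_seq] and [Series] they are total, and meaningful for convergent
    sequences only. *)
Definition CLim_seq (u : nat -> C) : C :=
  (real (Lim_seq (fun n => Re (u n))), real (Lim_seq (fun n => Im (u n)))).

Definition CSeries (u : nat -> C) : C :=
  (Series (fun n => Re (u n)), Series (fun n => Im (u n))).

Definition Cprod (l : list C) : C := fold_right Cmult 1 l.

(** Principal power [x ^ s = exp (s * ln x)] of a real [x > 0] with complex
    exponent [s]. *)
Definition rcpow (x : R) (s : C) : C :=
  ((exp (Re s * ln x) * cos (Im s * ln x))%R,
   (exp (Re s * ln x) * sin (Im s * ln x))%R).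

(** The entire function [1 / Gamma], by Gauss's product formula
    [1 / Gamma z = lim z (z + 1) ... (z + n) / (n! n ^ z)], in which the limit
    exists for every complex [z].  The value at [n = 0], where [rcpow 0 z] is
    meaningless, does not affect the limit. *)
Definition rGamma_seq (z : C) (n : nat) : C :=
  Cprod (map (fun k => z + INR k) (seq 0 (S n)))
  / (INR (fact n) * rcpow (INR n) z).

Definition rGamma (z : C) : C := CLim_seq (rGamma_seq z).

(** Significant away from the poles [0, -1, -2, ...], that is, from the zeros
    of [rGamma]. *)
Definition Gamma (z : C) : C := / rGamma z.

Definition pochhammer (g : C) (t : R) : C :=
  if Req_EM_T t 0 then 1 else Gamma (g + t) / Gamma g.

Definition bessel_maitland_term (delta gam v : C) (q : R) (z : C) (n : nat) : C :=
  pochhammer gam (q * INR n) * (- z) ^ n / INR (fact n)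
  * rGamma (delta * INR n + v + 1).

Definition bessel_maitland (delta gam v : C) (q : R) (z : C) : C :=
  CSeries (bessel_maitland_term delta gam v q z).

(** [num] is the list of the [(a_i, alpha_i)], [den] that of the
    [(b_j, beta_j)]. *)
Definition wright_term (num den : list (C * C)) (z : C) (k : nat) : C :=
  Cprod (map (fun p => Gamma (fst p + snd p * INR k)) num)
  * Cprod (map (fun p => rGamma (fst p + snd p * INR k)) den)
  * (z ^ k / INR (fact k)).

Definition wright (num den : list (C * C)) (z : C) : C :=
  CSeries (wright_term num den z).

(* Main.v *)
Require Import Defs.
From Stdlib Require Import Lra Lia.

(** The function [x / w x], where [w x = x + a + sqrt (x ^ 2 + 2 a x)], takes its
    values in [[0, 1 / 2]], so the Bessel-Maitland function may be integrated term
    by term. Its [n]-th term leaves the integral of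
    [x ^ (mu + n - 1) * w x ^ (- (lam + n))], which is Oberhettinger's integral
    with [mu] and [lam] shifted by [n]:
    [int x ^ (mu - 1) (w x) ^ (- lam) dx
      = 2 lam a ^ (- lam) (a / 2) ^ mu Gamma (2 mu) Gamma (lam - mu) / Gamma (1 + lam + mu)]
    for [0 < Re mu < Re lam]. As [Gamma (lam - mu)] is not affected by the shift,
    it comes out of the series, and what remains is the Wright series
    ([wright_term_bessel_maitland]).

    Oberhettinger's integral ([is_CInt_gen_ober]) becomes a sum of two Beta
    integrals under the substitution [t = 1 - a / w x]. The Beta integral
    ([is_Beta_Gamma]) is evaluated from Gauss's product alone: its recurrence in
    the second parameter gives [B (alpha, n + 1)] as the reciprocal of a term of
    the product, up to the factor [n ^ alpha], and reduces [B (alpha, beta)] to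
    [B (alpha, beta + n + 1)], which is asymptotic to [B (alpha, n + 1)].

    Termwise integration ([is_CInt_gen_termwise]) needs the Bessel-Maitland
    coefficients to decay faster than every geometric sequence
    ([ex_series_bessel_maitland_coeff]). As [q < 1 + Re delta], this follows from
    three estimates of quotients of Gamma values, each read off the factors of
    Gauss's product: a shift by a positive real on the real axis, from above and
    from below, and an imaginary shift, which costs a bounded factor and hence,
    after [n] shifts by [i Im delta], only a geometric one. *)

(** * Limits of complex sequences *)

(** Stated with moduli, so that the algebra of limits reduces to real estimates;
    [Ccv_Re_Im] and [Ccv_filterlim] relate it to limits taken componentwise and in
    the product topology. *)
Definition Ccv (u : nat -> C) (l : C) : Prop :=
  is_lim_seq (fun n => Cmod (u n - l)) 0.

Lemma Ccv_le (u : nat -> C) (l : C) (b : nat -> R) :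
  (forall n, (Cmod (u n - l) <= b n)%R) -> is_lim_seq b 0 -> Ccv u l.
Proof.
  intros H Hb. apply is_lim_seq_le_le with (fun _ => 0%R) b; trivial.
  - intros n; split; [apply Cmod_ge_0 | apply H].
  - apply is_lim_seq_const.
Qed.

Lemma Ccv_ext (u v : nat -> C) (l : C) :
  (forall n, u n = v n) -> Ccv u l -> Ccv v l.
Proof.
  intros H. apply is_lim_seq_ext. intros n. now rewrite H.
Qed.

Lemma Ccv_const (c : C) : Ccv (fun _ => c) c.
Proof.
  apply is_lim_seq_ext with (fun _ => 0%R); [|apply is_lim_seq_const].
  intros _. replace (c - c) with (RtoC 0) by ring. now rewrite Cmod_0.
Qed.

Lemma Ccv_incr_n (u : nat -> C) (N : nat) (l : C) :
  Ccv (fun n => u (n + N)%nat) l <-> Ccv u l.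
Proof.
  unfold Ccv. symmetry.
  apply (is_lim_seq_incr_n (fun n => Cmod (u n - l)) N).
Qed.

Lemma Ccv_plus (u v : nat -> C) (l m : C) :
  Ccv u l -> Ccv v m -> Ccv (fun n => u n + v n) (l + m).
Proof.
  intros Hu Hv. unfold Ccv in *.
  apply Ccv_le with (fun n => Cmod (u n - l) + Cmod (v n - m))%R.
  - intros n. replace (u n + v n - (l + m)) with ((u n - l) + (v n - m)) by ring.
    apply Cmod_triangle.
  - replace (Finite 0) with (Finite (0 + 0)) by (f_equal; ring).
    now apply is_lim_seq_plus'.
Qed.

Lemma Ccv_mult (u v : nat -> C) (l m : C) :
  Ccv u l -> Ccv v m -> Ccv (fun n => u n * v n) (l * m).
Proof.
  intros Hu Hv. unfold Ccv in *.
  apply Ccv_le with (fun n => Cmod (u n - l) * Cmod (v n - m)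
     + Cmod l * Cmod (v n - m) + Cmod (u n - l) * Cmod m)%R.
  - intros n. replace (u n * v n - l * m) with
      ((u n - l) * (v n - m) + l * (v n - m) + (u n - l) * m) by ring.
    rewrite <- !Cmod_mult.
    eapply Rle_trans; [apply Cmod_triangle|].
    apply Rplus_le_compat_r. apply Cmod_triangle.
  - replace (Finite 0) with (Finite (0 * 0 + Cmod l * 0 + 0 * Cmod m))
      by (f_equal; ring).
    apply is_lim_seq_plus'; [apply is_lim_seq_plus'|];
      apply is_lim_seq_mult'; trivial; apply is_lim_seq_const.
Qed.

Lemma Ccv_Cmod (u : nat -> C) (l : C) :
  Ccv u l -> is_lim_seq (fun n => Cmod (u n)) (Cmod l).
Proof.
  intros Hu.
  apply is_lim_seq_le_le with
    (fun n => Cmod l - Cmod (u n - l))%R (fun n => Cmod l + Cmod (u n - l))%R.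
  - intros n. split.
    + assert (H := Cmod_triangle (u n) (- (u n - l))).
      rewrite Cmod_opp in H.
      replace (u n + - (u n - l)) with l in H by ring. lra.
    + assert (H := Cmod_triangle l (u n - l)).
      replace (l + (u n - l)) with (u n) in H by ring. lra.
  - replace (Finite (Cmod l)) with (Finite (Cmod l - 0)) by (f_equal; ring).
    apply is_lim_seq_minus'; trivial. apply is_lim_seq_const.
  - replace (Finite (Cmod l)) with (Finite (Cmod l + 0)) by (f_equal; ring).
    apply is_lim_seq_plus'; trivial. apply is_lim_seq_const.
Qed.

Lemma Ccv_inv (u : nat -> C) (l : C) :
  l <> 0 -> (forall n, u n <> 0) -> Ccv u l -> Ccv (fun n => / u n) (/ l).
Proof.
  intros Hl Hn Hu.
  assert (Hl' : Cmod l <> 0%R) by (intros E; now apply Hl, Cmod_eq_0).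
  apply is_lim_seq_ext with
    (fun n => / (Cmod (u n) * Cmod l) * Cmod (u n - l))%R.
  - intros n. rewrite <- Cmod_mult, <- Cmod_inv, <- Cmod_mult.
    + rewrite <- Cmod_opp. f_equal. field. now split.
    + now apply Cmult_neq_0.
  - replace (Finite 0) with (Finite (/ (Cmod l * Cmod l) * 0)) by (f_equal; ring).
    apply is_lim_seq_mult'; trivial.
    apply is_lim_seq_inv with (l := Finite (Cmod l * Cmod l)).
    + apply is_lim_seq_mult'; [now apply Ccv_Cmod | apply is_lim_seq_const].
    + intros E. injection E. now apply Rmult_integral_contrapositive_currified.
Qed.

Lemma Ccv_unique (u : nat -> C) (l m : C) : Ccv u l -> Ccv u m -> l = m.
Proof.
  intros Hl Hm.
  assert (H : Ccv (fun n => u n + - (1) * u n) (l + - (1) * m)).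
  { apply Ccv_plus; trivial. apply Ccv_mult; trivial. apply Ccv_const. }
  apply Ccv_ext with (v := fun _ => RtoC 0) in H; [|intros; ring].
  apply Ccv_Cmod, is_lim_seq_unique in H.
  rewrite Cmod_0, Lim_seq_const in H. injection H as H.
  symmetry in H. apply Cmod_eq_0 in H.
  replace l with ((l + - (1) * m) + m) by ring. rewrite H. ring.
Qed.

Lemma im_le_Cmod (z : C) : (Rabs (Im z) <= Cmod z)%R.
Proof. eapply Rle_trans; [apply Rmax_r | apply Rmax_Cmod]. Qed.

Lemma Cmod_le_Re_Im (z : C) : (Cmod z <= Rabs (Re z) + Rabs (Im z))%R.
Proof.
  replace z with (RtoC (Re z) + Ci * RtoC (Im z)) at 1.
  - eapply Rle_trans; [apply Cmod_triangle|].
    rewrite Cmod_mult, Cmod_Ci, !Cmod_R. lra.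
  - destruct z; unfold Re, Im, Cplus, Cmult, Ci, RtoC; simpl. f_equal; ring.
Qed.

Lemma Ccv_Re_Im (u : nat -> C) (l : C) :
  Ccv u l <-> is_lim_seq (fun n => Re (u n)) (Re l) /\
              is_lim_seq (fun n => Im (u n)) (Im l).
Proof.
  split.
  - intros H.
    assert (E : forall f : C -> R, (forall z w, f (z - w) = (f z - f w)%R) ->
      (forall z, (Rabs (f z) <= Cmod z)%R) ->
      is_lim_seq (fun n => f (u n)) (f l)).
    { intros f Hf Hb.
      apply is_lim_seq_ext with (fun n => f (u n - l)%C + f l)%R.
      { intros n. rewrite Hf. ring. }
      replace (Finite (f l)) with (Finite (0 + f l)) by (f_equal; ring).
      apply is_lim_seq_plus'; [|apply is_lim_seq_const].
      apply is_lim_seq_abs_0.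
      apply is_lim_seq_le_le with (fun _ => 0%R) (fun n => Cmod (u n - l)).
      - intros n; split; [apply Rabs_pos | apply Hb].
      - apply is_lim_seq_const.
      - exact H. }
    split; apply E; try reflexivity; [apply re_le_Cmod | apply im_le_Cmod].
  - intros [H1 H2].
    apply Ccv_le with (fun n => Rabs (Re (u n) - Re l) + Rabs (Im (u n) - Im l))%R.
    + intros n. apply Cmod_le_Re_Im.
    + replace (Finite 0) with (Finite (Rabs (Re l - Re l) + Rabs (Im l - Im l))).
      * apply is_lim_seq_plus';
          apply (is_lim_seq_abs _ (Finite _)); apply is_lim_seq_minus'; trivial;
          apply is_lim_seq_const.
      * f_equal. rewrite !Rminus_diag, Rabs_R0. ring.
Qed.

Lemma CLim_seq_unique (u : nat -> C) (l : C) : Ccv u l -> CLim_seq u = l.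
Proof.
  intros H. apply Ccv_Re_Im in H as [H1 H2]. unfold CLim_seq.
  apply is_lim_seq_unique in H1, H2. rewrite H1, H2. now destruct l.
Qed.

Lemma Ccv_filterlim (u : nat -> C) (l : C) :
  Ccv u l <-> filterlim u eventually (locally (T := C_R_NormedModule) l).
Proof.
  unfold Ccv, is_lim_seq.
  split; intros H.
  - apply (filterlim_locally (U := C_R_NormedModule)). intros eps.
    apply (filterlim_locally (U := R_UniformSpace)) with (eps := eps) in H. simpl in H.
    revert H. apply filter_imp. intros n Hn.
    apply C_NormedModule_mixin_compat1.
    revert Hn. unfold ball; simpl; unfold AbsRing_ball, abs, minus, plus, opp; simpl.
    rewrite Ropp_0, Rplus_0_r, Rabs_pos_eq; [trivial | apply Cmod_ge_0].
  - apply (filterlim_locally (U := R_UniformSpace)). intros eps. simpl.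
    assert (He : (0 < eps / sqrt 2)%R).
    { apply Rdiv_lt_0_compat; [apply eps | apply sqrt_lt_R0; lra]. }
    assert (H' := proj1 (filterlim_locally (U := C_R_NormedModule) u l) H
      (mkposreal _ He)).
    revert H'. apply filter_imp. intros n Hn.
    apply C_NormedModule_mixin_compat2 in Hn. simpl in Hn.
    unfold ball; simpl; unfold AbsRing_ball, abs, minus, plus, opp; simpl.
    rewrite Ropp_0, Rplus_0_r, Rabs_pos_eq; [|apply Cmod_ge_0].
    unfold minus, plus, opp in Hn; simpl in Hn.
    replace (sqrt 2 * (eps / sqrt 2))%R with (pos eps) in Hn; [exact Hn|].
    field. apply Rgt_not_eq, sqrt_lt_R0; lra.
Qed.

(** * Powers of positive reals with complex exponents *)

Lemma rcpow_RtoC (x s : R) : rcpow x s = RtoC (exp (s * ln x)).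
Proof.
  unfold rcpow, RtoC, Re, Im; simpl. rewrite Rmult_0_l, cos_0, sin_0. f_equal; ring.
Qed.

Lemma Cmod_rcpow (x : R) (s : C) : Cmod (rcpow x s) = exp (Re s * ln x).
Proof.
  unfold Cmod, rcpow; simpl fst; simpl snd.
  assert (H := sin2_cos2 (Im s * ln x)). unfold Rsqr in H.
  transitivity (sqrt (exp (Re s * ln x) ^ 2)).
  - f_equal. rewrite <- (Rmult_1_r (exp _ ^ 2)), <- H. ring.
  - apply sqrt_pow2, Rlt_le, exp_pos.
Qed.

Lemma rcpow_neq_0 (x : R) (s : C) : rcpow x s <> 0.
Proof.
  intros E. assert (H := Cmod_rcpow x s). rewrite E, Cmod_0 in H.
  assert (H' := exp_pos (Re s * ln x)). lra.
Qed.

Lemma rcpow_plus (x : R) (s t : C) : rcpow x (s + t) = rcpow x s * rcpow x t.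
Proof.
  unfold rcpow, Cplus, Cmult, Re, Im; simpl.
  rewrite !Rmult_plus_distr_r, exp_plus, cos_plus, sin_plus. f_equal; ring.
Qed.

Lemma rcpow_0_r (x : R) : rcpow x 0 = 1.
Proof. rewrite rcpow_RtoC, Rmult_0_l, exp_0. reflexivity. Qed.

Lemma rcpow_opp (x : R) (s : C) : rcpow x (- s) = / rcpow x s.
Proof.
  assert (H := rcpow_plus x s (- s)).
  replace (s + - s) with (RtoC 0) in H by ring. rewrite rcpow_0_r in H.
  replace (/ rcpow x s) with (/ rcpow x s * 1) by ring.
  rewrite H. field. apply rcpow_neq_0.
Qed.

Lemma rcpow_1_r (x : R) : (0 < x)%R -> rcpow x 1 = x.
Proof. intros H. rewrite rcpow_RtoC, Rmult_1_l, exp_ln; trivial. Qed.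

Lemma rcpow_INR (x : R) (n : nat) : (0 < x)%R -> rcpow x (INR n) = RtoC x ^ n.
Proof.
  intros H. induction n as [|n IH].
  - apply rcpow_0_r.
  - rewrite S_INR, RtoC_plus, rcpow_plus, IH, rcpow_1_r; trivial.
    simpl. ring.
Qed.

Lemma rcpow_mult_l (x y : R) (s : C) :
  (0 < x)%R -> (0 < y)%R -> rcpow (x * y) s = rcpow x s * rcpow y s.
Proof.
  intros Hx Hy. unfold rcpow, Cmult, Re, Im; simpl.
  rewrite ln_mult, !Rmult_plus_distr_l, exp_plus, cos_plus, sin_plus; trivial.
  f_equal; ring.
Qed.

Lemma rcpow_inv_l (x : R) (s : C) : (0 < x)%R -> rcpow (/ x) s = rcpow x (- s).
Proof.
  intros Hx. unfold rcpow, Re, Im; simpl. rewrite ln_Rinv by trivial.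
  f_equal; [f_equal|f_equal]; f_equal; ring.
Qed.

Lemma rcpow_1_l (s : C) : rcpow 1 s = 1.
Proof.
  unfold rcpow. rewrite ln_1, !Rmult_0_r, exp_0, cos_0, sin_0.
  unfold RtoC. f_equal; ring.
Qed.

(** * Derivatives of complex functions of a real variable *)

Definition is_Cderive (f : R -> C) (x : R) (l : C) : Prop :=
  is_derive (fun t => Re (f t)) x (Re l) /\
  is_derive (fun t => Im (f t)) x (Im l).

Lemma is_Cderive_ext_val (f : R -> C) (x : R) (l m : C) :
  l = m -> is_Cderive f x l -> is_Cderive f x m.
Proof. now intros ->. Qed.

Lemma is_Cderive_const (c : C) (x : R) : is_Cderive (fun _ => c) x 0.
Proof.
  split; simpl; apply (is_derive_const (V := R_NormedModule)).
Qed.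

Lemma is_Cderive_id (x : R) : is_Cderive RtoC x 1.
Proof.
  split; simpl; [apply (is_derive_id (K := R_AbsRing)) |
    apply (is_derive_const (V := R_NormedModule))].
Qed.

Lemma is_Cderive_plus (f g : R -> C) (x : R) (l m : C) :
  is_Cderive f x l -> is_Cderive g x m ->
  is_Cderive (fun t => f t + g t) x (l + m).
Proof.
  intros [Hf1 Hf2] [Hg1 Hg2]. split; simpl.
  - exact (is_derive_plus (V := R_NormedModule) _ _ _ _ _ Hf1 Hg1).
  - exact (is_derive_plus (V := R_NormedModule) _ _ _ _ _ Hf2 Hg2).
Qed.

Lemma is_Cderive_mult (f g : R -> C) (x : R) (l m : C) :
  is_Cderive f x l -> is_Cderive g x m ->
  is_Cderive (fun t => f t * g t) x (l * g x + f x * m).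
Proof.
  intros [Hf1 Hf2] [Hg1 Hg2].
  assert (P : forall (a b : R -> R) (a' b' : R), is_derive a x a' ->
    is_derive b x b' -> is_derive (fun t => a t * b t)%R x (a' * b x + a x * b')%R).
  { intros. apply (is_derive_mult a b); trivial. intros; apply Rmult_comm. }
  split; unfold Cmult, Cplus, Re, Im in *; simpl fst; simpl snd.
  - refine (eq_rect _ (is_derive _ x) (is_derive_minus (V := R_NormedModule)
      _ _ _ _ _ (P _ _ _ _ Hf1 Hg1) (P _ _ _ _ Hf2 Hg2)) _ _).
    unfold minus, plus, opp; simpl. ring.
  - refine (eq_rect _ (is_derive _ x) (is_derive_plus (V := R_NormedModule)
      _ _ _ _ _ (P _ _ _ _ Hf1 Hg2) (P _ _ _ _ Hf2 Hg1)) _ _).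
    unfold plus; simpl. ring.
Qed.

Lemma is_Cderive_comp (f : R -> C) (g : R -> R) (x g' : R) (l : C) :
  is_Cderive f (g x) l -> is_derive g x g' ->
  is_Cderive (fun t => f (g t)) x (RtoC g' * l).
Proof.
  intros [H1 H2] Hg.
  split; unfold Cmult, RtoC, Re, Im in *; simpl fst; simpl snd.
  - replace (_ - _)%R with (scal g' (fst l)) by (unfold scal; simpl; unfold mult; simpl; ring).
    exact (is_derive_comp (V := R_NormedModule) _ _ _ _ _ H1 Hg).
  - replace (_ + _)%R with (scal g' (snd l)) by (unfold scal; simpl; unfold mult; simpl; ring).
    exact (is_derive_comp (V := R_NormedModule) _ _ _ _ _ H2 Hg).
Qed.

Lemma is_Cderive_rcpow (s : C) (x : R) :
  (0 < x)%R -> is_Cderive (fun t => rcpow t s) x (s * rcpow x (s - 1)).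
Proof.
  intros Hx.
  assert (E : exp ((Re s - 1) * ln x) = (exp (Re s * ln x) / x)%R).
  { replace ((Re s - 1) * ln x)%R with (Re s * ln x + - ln x)%R by ring.
    rewrite exp_plus, exp_Ropp, exp_ln; trivial. }
  unfold rcpow.
  replace (Re (s - 1)) with (Re s - 1)%R by (unfold Re; simpl; ring).
  replace (Im (s - 1)) with (Im s)%R by (unfold Im; simpl; ring).
  rewrite E. split; unfold Cmult, Re, Im; simpl fst; simpl snd;
    auto_derive; [repeat split; trivial | field; lra | repeat split; trivial | field; lra].
Qed.

Lemma is_Cderive_continuous (f : R -> C) (x : R) (l : C) :
  is_Cderive f x l ->
  continuous (fun t => Re (f t)) x /\ continuous (fun t => Im (f t)) x.
Proof.
  intros [H1 H2].
  split; apply (ex_derive_continuous (V := R_NormedModule)); eexists; eassumption.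
Qed.

(** The hypothesis is symmetric in [s] because it is the one of the real mean
    value theorem [bounded_variation]. The factor [2] comes from applying that
    theorem to the real and imaginary parts separately. *)
Lemma Cmod_mean_value (f f' : R -> C) (D t : R) :
  (0 <= t)%R ->
  (forall s, (Rabs s <= t)%R -> is_Cderive f s (f' s) /\ (Cmod (f' s) <= D)%R) ->
  (Cmod (f t - f 0%R) <= 2 * D * t)%R.
Proof.
  intros Ht H.
  assert (B : forall g : C -> R, (forall z, Rabs (g z) <= Cmod z)%R ->
    (forall s, (Rabs s <= t)%R -> is_derive (fun u => g (f u)) s (g (f' s))) ->
    (Rabs (g (f t) - g (f 0%R)) <= D * t)%R).
  { intros g Hg Hd.
    rewrite <- (Rabs_pos_eq t Ht) at 2. rewrite <- (Rminus_0_r t) at 2.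
    apply (bounded_variation (fun u => g (f u)) (fun u => g (f' u))).
    intros s Hs. rewrite !Rminus_0_r, (Rabs_pos_eq t Ht) in Hs. split; [now apply Hd|].
    eapply Rle_trans; [apply Hg|]. now apply H. }
  eapply Rle_trans; [apply Cmod_le_Re_Im|].
  assert (B1 := B Re re_le_Cmod (fun s Hs => proj1 (proj1 (H s Hs)))).
  assert (B2 := B Im im_le_Cmod (fun s Hs => proj2 (proj1 (H s Hs)))).
  change (Re (f t - f 0%R)) with (Re (f t) - Re (f 0%R))%R.
  change (Im (f t - f 0%R)) with (Im (f t) - Im (f 0%R))%R.
  lra.
Qed.

Lemma exp_le (x y : R) : (x <= y)%R -> (exp x <= exp y)%R.
Proof.
  intros [H| ->]; [apply Rlt_le; now apply exp_increasing | apply Rle_refl].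
Qed.

Lemma exp_mul_ln_le (a u : R) :
  (/ 2 <= u <= 2)%R -> (exp (a * ln u) <= exp (Rabs a * ln 2))%R.
Proof.
  intros [H1 H2].
  assert (L : (Rabs (ln u) <= ln 2)%R).
  { apply Rabs_le. split.
    - rewrite <- ln_Rinv by lra. apply ln_le; lra.
    - apply ln_le; lra. }
  apply exp_le. eapply Rle_trans; [apply Rle_abs|].
  rewrite Rabs_mult. apply Rmult_le_compat_l; [apply Rabs_pos | trivial].
Qed.

(** * Infinite products *)

Lemma ex_series_C (a : nat -> C) (b : nat -> R) :
  (forall n, (Cmod (a n) <= b n)%R) -> ex_series b ->
  ex_series (V := C_R_NormedModule) a.
Proof.
  intros H. apply (ex_series_le (V := C_R_CompleteNormedModule)).
  intros n. change (norm (a n)) with (norm (a n : C_R_NormedModule)).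
  rewrite <- Cmod_norm. apply H.
Qed.

(** The partial products are bounded by [|u 0| exp (sum |e|)], so the increments
    [u n * e n] are absolutely summable. *)
Lemma Ccv_product (u e : nat -> C) :
  (forall n, u (S n) = u n * (1 + e n)) -> ex_series (fun n => Cmod (e n)) ->
  exists l, Ccv u l.
Proof.
  intros Hu He.
  assert (B : forall n, (Cmod (u n) <=
    Cmod (u O) * exp (Series (fun k => Cmod (e k))))%R).
  { assert (I : forall n, (Cmod (u (S n)) <= Cmod (u O) * exp (sum_n (fun k => Cmod (e k)) n))%R).
    { assert (St : forall k, (Cmod (u (S k)) <= Cmod (u k) * exp (Cmod (e k)))%R).
      { intros k. rewrite Hu, Cmod_mult.
        apply Rmult_le_compat_l; [apply Cmod_ge_0|].
        eapply Rle_trans; [apply Cmod_triangle|]. rewrite Cmod_1.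
        apply exp_ineq1_le. }
      intros n. induction n as [|n IH].
      - rewrite sum_O. apply St.
      - rewrite sum_Sn. unfold plus; simpl. rewrite exp_plus, <- Rmult_assoc.
        eapply Rle_trans; [apply St|].
        apply Rmult_le_compat_r; [apply Rlt_le, exp_pos | exact IH]. }
    assert (P : forall m, (sum_n (fun k => Cmod (e k)) m <= Series (fun k => Cmod (e k)))%R).
    { intros m.
      apply (is_lim_seq_incr_compare (sum_n (fun k => Cmod (e k)))).
      - now apply Series_correct.
      - intros k. rewrite sum_Sn. unfold plus; simpl.
        assert (H := Cmod_ge_0 (e (S k))). lra. }
    intros [|n].
    - rewrite <- (Rmult_1_r (Cmod (u O))) at 1.
      apply Rmult_le_compat_l; [apply Cmod_ge_0|].
      rewrite <- exp_0. apply exp_le.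
      eapply Rle_trans; [|apply (P O)]. rewrite sum_O. apply Cmod_ge_0.
    - eapply Rle_trans; [apply I|].
      apply Rmult_le_compat_l; [apply Cmod_ge_0|]. apply exp_le, P. }
  set (M := (Cmod (u O) * exp (Series (fun k => Cmod (e k))))%R) in B.
  destruct (ex_series_C (fun n => u n * e n) (fun n => M * Cmod (e n))%R) as [l Hl].
  - intros n. rewrite Cmod_mult.
    apply Rmult_le_compat_r; [apply Cmod_ge_0 | apply B].
  - apply (ex_series_scal (V := R_NormedModule)); exact He.
  - apply Ccv_filterlim in Hl.
    exists (l + u O). apply (Ccv_incr_n u 1).
    apply Ccv_ext with (fun n =>
      sum_n (G := C_R_NormedModule) (fun n => u n * e n) n + u O).
    + intros n. rewrite Nat.add_1_r. induction n as [|n IH].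
      * rewrite sum_O, Hu. ring.
      * rewrite sum_Sn, (Hu (S n)). change plus with Cplus.
        match goal with |- ?s + ?t + _ = _ =>
          transitivity ((s + u O) + t); [ring|] end.
        rewrite IH. ring.
    + apply Ccv_plus; [exact Hl | apply Ccv_const].
Qed.

Lemma Ccv_product_neq_0 (u e : nat -> C) (l : C) :
  (forall n, u (S n) = u n * (1 + e n)) -> ex_series (fun n => Cmod (e n)) ->
  (forall n, u n <> 0) -> Ccv u l -> l <> 0.
Proof.
  intros Hu He H0 Hl.
  assert (Hsmall : eventually (fun n => (Cmod (e n) < / 2)%R)).
  { assert (H := ex_series_lim_0 _ He).
    apply (is_lim_seq_spec _ 0) in H.
    specialize (H (mkposreal (/ 2) ltac:(lra))). revert H. apply filter_imp.
    intros n. simpl. rewrite Rminus_0_r, Rabs_pos_eq; [trivial | apply Cmod_ge_0]. }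
  destruct Hsmall as [N HN].
  assert (Hne : forall n, 1 + e (n + N)%nat <> 0).
  { intros n E. assert (H := HN (n + N)%nat ltac:(lia)).
    replace (e (n + N)%nat) with (- (1)) in H.
    - rewrite Cmod_m1 in H. lra.
    - replace (e (n + N)%nat) with (1 + e (n + N)%nat - 1) by ring. rewrite E. ring. }
  (* The reciprocals also form a convergent product, and the limit of [u / u]
     is [1]. *)
  destruct (Ccv_product (fun n => / u (n + N)%nat)
    (fun n => - e (n + N)%nat / (1 + e (n + N)%nat))) as [m Hm].
  - intros n. simpl. rewrite Hu. field. split; [apply Hne | apply H0].
  - apply (ex_series_le (V := R_CompleteNormedModule) _
      (fun n => 2 * Cmod (e (n + N)%nat))%R).
    + intros n. unfold norm; simpl. unfold abs; simpl.
      rewrite Rabs_pos_eq, Cmod_div, Cmod_opp; [|apply Hne|apply Cmod_ge_0].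
      assert (H := HN (n + N)%nat ltac:(lia)).
      assert (H1 : (/ 2 <= Cmod (1 + e (n + N)%nat))%R).
      { assert (T := Cmod_triangle (1 + e (n + N)%nat) (- e (n + N)%nat)).
        replace (1 + e (n + N)%nat + - e (n + N)%nat) with (RtoC 1) in T by ring.
        rewrite Cmod_opp, Cmod_1 in T. lra. }
      apply Rle_div_l; [lra|].
      assert (H2 := Cmod_ge_0 (e (n + N)%nat)). nra.
    + apply (ex_series_scal (V := R_NormedModule)).
      apply ex_series_ext with (fun n => Cmod (e (N + n)%nat)).
      { intros n. now rewrite Nat.add_comm. }
      exact (proj1 (ex_series_incr_n (V := R_NormedModule)
        (fun n => Cmod (e n)) N) He).
  - intros ->.
    apply (Ccv_incr_n u N) in Hl.
    assert (H := Ccv_mult _ _ _ _ Hl Hm).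
    apply Ccv_ext with (v := fun _ => RtoC 1) in H.
    + assert (E := Ccv_unique _ _ _ H (Ccv_const 1)).
      replace (0 * m) with (RtoC 0) in E by ring. injection E. lra.
    + intros n. now apply Cinv_r.
Qed.

(** * The Gauss product *)

(** Written with [Cprod], so that the numerator of [rGamma_seq] is an instance by
    computation. *)
Definition rising (z : C) (n : nat) : C :=
  Cprod (map (fun k => z + INR k) (seq 0 n)).

Lemma rising_S (z : C) (n : nat) : rising z (S n) = rising z n * (z + INR n).
Proof.
  unfold rising. rewrite seq_S, map_app. simpl map. simpl (0 + n)%nat.
  induction (map _ (seq 0 n)) as [|c l IH]; simpl.
  - ring.
  - change (Cprod (c :: ?l)) with (c * Cprod l). rewrite IH. ring.
Qed.

Lemma rising_shift (z : C) (n : nat) : rising z (S n) = z * rising (z + 1) n.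
Proof.
  induction n as [|n IH].
  - rewrite rising_S. unfold rising. simpl. ring.
  - rewrite rising_S, IH, (rising_S (z + 1)), S_INR, RtoC_plus. ring.
Qed.

Lemma rising_neq_0 (z : C) (n : nat) :
  (forall k : nat, z + INR k <> 0) -> rising z n <> 0.
Proof.
  intros H. induction n as [|n IH].
  - unfold rising. simpl. intros E. injection E. lra.
  - rewrite rising_S. now apply Cmult_neq_0.
Qed.

Lemma RtoC_neq_0 (x : R) : x <> 0%R -> RtoC x <> 0.
Proof. intros H E. apply H. now injection E. Qed.

Lemma INR_fact_neq_0_C (n : nat) : RtoC (INR (fact n)) <> 0.
Proof. apply RtoC_neq_0, INR_fact_neq_0. Qed.

Lemma rGamma_seq_rising (z : C) (n : nat) :
  rGamma_seq z n = rising z (S n) / (INR (fact n) * rcpow (INR n) z).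
Proof. reflexivity. Qed.

(** [(1 - t) ^ z = 1 - z t + O(t ^ 2)], in the form suited to the quotient of
    consecutive terms of the Gauss product: the derivative of the left-hand
    product is [- z (z + 1) t (1 - t) ^ (z - 1)]. *)
Lemma gauss_factor_bound (z : C) :
  exists K : R, forall t : R, (0 <= t <= / 2)%R ->
    (Cmod ((1 + z * t) * rcpow (1 - t) z - 1) <= K * t ^ 2)%R.
Proof.
  set (M := (Cmod (z * (z + 1)) * exp (Rabs (Re (z - 1)) * ln 2))%R).
  exists (2 * M)%R. intros t Ht.
  replace (RtoC 1) with ((1 + z * RtoC 0) * rcpow (1 - 0) z) at 2.
  2: { rewrite Rminus_0_r, rcpow_1_l. ring. }
  replace (2 * M * t ^ 2)%R with (2 * (M * t) * t)%R by ring.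
  apply (Cmod_mean_value (fun t => (1 + z * RtoC t) * rcpow (1 - t) z)
    (fun t => - (z * (z + 1)) * t * rcpow (1 - t) (z - 1))); [lra|].
  intros s Hs.
  assert (Hs' : (/ 2 <= 1 - s <= 2)%R).
  { assert (A := Rle_abs s). assert (B := Rle_abs (- s)).
    rewrite Rabs_Ropp in B. lra. }
  split.
  - eapply is_Cderive_ext_val.
    2: { apply is_Cderive_mult.
         - apply is_Cderive_plus; [apply is_Cderive_const|].
           apply is_Cderive_mult; [apply is_Cderive_const|].
           apply is_Cderive_id.
         - apply (is_Cderive_comp (fun u => rcpow u z) (fun u => 1 - u)%R s (-1)%R).
           + apply is_Cderive_rcpow; lra.
           + auto_derive; [trivial | ring]. }
    cbv beta. replace (rcpow (1 - s) z) with (rcpow (1 - s) (z - 1) * (1 - RtoC s)).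
    + rewrite (RtoC_opp 1 : RtoC (-1)%R = - (1)). ring.
    + rewrite <- RtoC_minus, <- (rcpow_1_r (1 - s)) at 1 by lra.
      rewrite <- rcpow_plus. f_equal. ring.
  - rewrite !Cmod_mult, Cmod_opp, Cmod_R, Cmod_rcpow.
    unfold M. rewrite Rmult_assoc, Rmult_assoc.
    apply Rmult_le_compat_l; [apply Cmod_ge_0|]. rewrite Rmult_comm.
    apply Rmult_le_compat; [apply Rlt_le, exp_pos | apply Rabs_pos | | trivial].
    now apply exp_mul_ln_le.
Qed.

Lemma is_lim_seq_inv_INR : is_lim_seq (fun n => / INR n)%R 0.
Proof.
  apply (is_lim_seq_inv _ p_infty); [apply is_lim_seq_INR | discriminate].
Qed.

Lemma Ccv_RtoC (u : nat -> R) (l : R) : is_lim_seq u l -> Ccv (fun n => RtoC (u n)) l.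
Proof.
  intros H. apply Ccv_Re_Im. split; [exact H | apply is_lim_seq_const].
Qed.

Lemma ex_series_inv_square : ex_series (fun n => (/ INR (n + 2)) ^ 2)%R.
Proof.
  apply (ex_series_le (V := R_CompleteNormedModule) _
    (fun n => / INR (n + 1) - / INR (n + 2))%R).
  - intros n. unfold norm; simpl. unfold abs; simpl.
    rewrite !plus_INR. simpl (INR 1). simpl (INR 2).
    assert (H := pos_INR n).
    replace (1 + 1)%R with 2%R by ring.
    rewrite Rmult_1_r, Rabs_pos_eq.
    + replace (/ (INR n + 1) - / (INR n + 2))%R
        with (/ (INR n + 1) * / (INR n + 2))%R by (field; lra).
      apply Rmult_le_compat_r; [apply Rlt_le, Rinv_0_lt_compat; lra|].
      apply Rinv_le_contravar; lra.
    + apply Rlt_le, Rmult_lt_0_compat; apply Rinv_0_lt_compat; lra.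
  - exists 1%R. change (is_lim_seq (sum_n (fun n => / INR (n + 1) - / INR (n + 2))%R) 1).
    apply is_lim_seq_ext with (fun n => 1 - / INR (n + 2))%R.
    + intros n. induction n as [|n IH].
      * rewrite sum_O. simpl. field.
      * rewrite sum_Sn, <- IH. unfold plus; simpl (AbelianMonoid.plus _ _).
        replace (S n + 1)%nat with (n + 2)%nat by lia. simpl. ring.
    + replace (Finite 1) with (Finite (1 - 0)) by (f_equal; ring).
      apply is_lim_seq_minus'; [apply is_lim_seq_const|].
      apply (is_lim_seq_incr_n (fun n => / INR n)%R 2), is_lim_seq_inv_INR.
Qed.

(** [1 + gauss_error z n] is the quotient of the terms of index [n + 2] and
    [n + 1] of the Gauss product; the term of index [0] is skipped because [ln 0]
    is meaningless. *)
Definition gauss_error (z : C) (n : nat) : C :=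
  (1 + z * RtoC (/ INR (n + 2))) * rcpow (1 - / INR (n + 2)) z - 1.

Lemma gauss_step (z : C) (n : nat) :
  rGamma_seq z (S (S n)) = rGamma_seq z (S n) * (1 + gauss_error z n).
Proof.
  unfold gauss_error. rewrite !rGamma_seq_rising, (rising_S z (S (S n))).
  assert (Hn := pos_INR n).
  replace (fact (S (S n))) with ((S (S n)) * fact (S n))%nat by reflexivity.
  rewrite mult_INR, RtoC_mult.
  replace (n + 2)%nat with (S (S n)) by lia.
  assert (H1 : (0 < INR (S n))%R) by (rewrite S_INR; lra).
  assert (H2 : (0 < INR (S (S n)))%R) by (rewrite !S_INR; lra).
  replace (1 - / INR (S (S n)))%R with (INR (S n) * / INR (S (S n)))%R.
  2: { rewrite (S_INR (S n)) in *. field; lra. }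
  rewrite rcpow_mult_l, rcpow_inv_l, rcpow_opp, RtoC_inv; trivial; [|lra|].
  2: now apply Rinv_0_lt_compat.
  field. repeat split; try apply rcpow_neq_0; try apply INR_fact_neq_0_C.
  apply RtoC_neq_0; lra.
Qed.

Lemma ex_series_gauss_error (z : C) : ex_series (fun n => Cmod (gauss_error z n)).
Proof.
  destruct (gauss_factor_bound z) as [K HK].
  apply (ex_series_le (V := R_CompleteNormedModule) _
    (fun n => K * (/ INR (n + 2)) ^ 2)%R).
  - intros n. unfold norm; simpl norm. unfold abs; simpl abs.
    rewrite Rabs_pos_eq by apply Cmod_ge_0. apply HK.
    rewrite plus_INR. simpl (INR 2). assert (H := pos_INR n). split.
    + apply Rlt_le, Rinv_0_lt_compat; lra.
    + apply Rinv_le_contravar; lra.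
  - apply (ex_series_scal (V := R_NormedModule)), ex_series_inv_square.
Qed.

Lemma rGamma_correct (z : C) : Ccv (rGamma_seq z) (rGamma z).
Proof.
  destruct (Ccv_product (fun n => rGamma_seq z (S n)) (gauss_error z)) as [l Hl].
  - apply gauss_step.
  - apply ex_series_gauss_error.
  - assert (H : Ccv (rGamma_seq z) l).
    { apply (Ccv_incr_n _ 1). apply Ccv_ext with (2 := Hl).
      intros n. now rewrite Nat.add_1_r. }
    unfold rGamma. now rewrite (CLim_seq_unique _ _ H).
Qed.

Lemma Cinv_neq_0 (z : C) : z <> 0 -> / z <> 0.
Proof.
  intros H E. assert (H1 := Cinv_r z H). rewrite E, Cmult_0_r in H1.
  injection H1. lra.
Qed.

Lemma rGamma_seq_neq_0 (z : C) (n : nat) :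
  (forall k : nat, z + INR k <> 0) -> rGamma_seq z n <> 0.
Proof.
  intros H. rewrite rGamma_seq_rising. unfold Cdiv.
  apply Cmult_neq_0; [now apply rising_neq_0|].
  apply Cinv_neq_0, Cmult_neq_0; [apply INR_fact_neq_0_C | apply rcpow_neq_0].
Qed.

Lemma rGamma_neq_0 (z : C) :
  (forall k : nat, z + INR k <> 0) -> rGamma z <> 0.
Proof.
  intros H.
  apply (Ccv_product_neq_0 (fun n => rGamma_seq z (S n)) (gauss_error z)).
  - apply gauss_step.
  - apply ex_series_gauss_error.
  - intros n. now apply rGamma_seq_neq_0.
  - apply Ccv_ext with (fun n => rGamma_seq z (n + 1)).
    + intros n. now rewrite Nat.add_1_r.
    + apply (Ccv_incr_n (rGamma_seq z) 1), rGamma_correct.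
Qed.

Lemma Re_pos_not_pole (z : C) (k : nat) : (0 < Re z)%R -> z + INR k <> 0.
Proof.
  intros H E. apply (f_equal Re) in E.
  change (Re z + INR k = 0)%R in E. assert (P := pos_INR k). lra.
Qed.

Lemma rGamma_neq_0_Re (z : C) : (0 < Re z)%R -> rGamma z <> 0.
Proof. intros H. apply rGamma_neq_0. intros k. now apply Re_pos_not_pole. Qed.

(** The [n]-th term of the product for [z + 1], multiplied by [z], is that of the
    product for [z] multiplied by [(z + n + 1) / n], which tends to [1]. *)
Lemma rGamma_recurrence (z : C) : rGamma z = z * rGamma (z + 1).
Proof.
  apply Ccv_unique with (fun n => rGamma_seq z (n + 1) * (1 + (z + 1) * RtoC (/ INR (n + 1)))).
  - replace (rGamma z) with (rGamma z * (1 + (z + 1) * 0)) by ring.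
    apply Ccv_mult; [apply (Ccv_incr_n (rGamma_seq z) 1), rGamma_correct|].
    apply Ccv_plus; [apply Ccv_const|]. apply Ccv_mult; [apply Ccv_const|].
    apply Ccv_RtoC, (is_lim_seq_incr_n (fun n => / INR n)%R 1), is_lim_seq_inv_INR.
  - apply Ccv_ext with (fun n => z * rGamma_seq (z + 1) (n + 1)).
    + intros n. rewrite !rGamma_seq_rising.
      assert (E := rising_shift z (S (n + 1))). rewrite rising_S in E.
      assert (Hn : (0 < INR (n + 1))%R).
      { rewrite plus_INR. simpl (INR 1). assert (H := pos_INR n). lra. }
      assert (Hn' := RtoC_neq_0 _ (Rgt_not_eq _ _ Hn)).
      rewrite rcpow_plus, rcpow_1_r, (RtoC_inv _ (Rgt_not_eq _ _ Hn)) by lra.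
      transitivity (z * rising (z + 1) (S (n + 1)) /
        (INR (fact (n + 1)) * (rcpow (INR (n + 1)) z * INR (n + 1)))).
      { unfold Cdiv. ring. }
      rewrite <- E, S_INR, RtoC_plus. field.
      repeat split; trivial; first [apply INR_fact_neq_0_C | apply rcpow_neq_0].
    + apply Ccv_mult; [apply Ccv_const|].
      apply (Ccv_incr_n (rGamma_seq (z + 1)) 1), rGamma_correct.
Qed.

Lemma Gamma_recurrence (z : C) :
  z <> 0 -> rGamma (z + 1) <> 0 -> Gamma (z + 1) = z * Gamma z.
Proof.
  intros Hz H. unfold Gamma. rewrite (rGamma_recurrence z). field. now split.
Qed.

(** * Growth of the Gamma function *)

(** Each estimate below compares the terms of two Gauss products factor by
    factor; this passes it to the limit. *)
Lemma Cmod_rGamma_le (z w : C) (K : R) (b : nat -> R) :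
  eventually (fun n => Cmod (rGamma_seq z n) <= b n * Cmod (rGamma_seq w n))%R ->
  is_lim_seq b K -> (Cmod (rGamma z) <= K * Cmod (rGamma w))%R.
Proof.
  intros H Hb.
  apply (is_lim_seq_le_loc (fun n => Cmod (rGamma_seq z n))
    (fun n => b n * Cmod (rGamma_seq w n))%R (Cmod (rGamma z))
    (K * Cmod (rGamma w))%R); trivial.
  - apply Ccv_Cmod, rGamma_correct.
  - apply is_lim_seq_mult'; trivial. apply Ccv_Cmod, rGamma_correct.
Qed.

Lemma Cmod_rGamma_seq (z : C) (n : nat) :
  Cmod (rGamma_seq z n) =
    (Cmod (rising z (S n)) / (INR (fact n) * exp (Re z * ln (INR n))))%R.
Proof.
  rewrite rGamma_seq_rising, Cmod_div, Cmod_mult, Cmod_R, Cmod_rcpow, Rabs_pos_eq.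
  - reflexivity.
  - apply pos_INR.
  - apply Cmult_neq_0; [apply INR_fact_neq_0_C | apply rcpow_neq_0].
Qed.

Lemma gauss_denominator_pos (z : C) (n : nat) :
  (0 < INR (fact n) * exp (Re z * ln (INR n)))%R.
Proof. apply Rmult_lt_0_compat; [apply INR_fact_lt_0 | apply exp_pos]. Qed.

(** Since [|z + k| >= Re z + k]. *)
Lemma Cmod_rGamma_Re (z : C) :
  (0 <= Re z)%R -> (Cmod (rGamma (RtoC (Re z))) <= Cmod (rGamma z))%R.
Proof.
  intros Hz. rewrite <- (Rmult_1_l (Cmod (rGamma z))).
  apply Cmod_rGamma_le with (fun _ => 1%R); [|apply is_lim_seq_const].
  exists O. intros n _. rewrite !Cmod_rGamma_seq, Rmult_1_l.
  apply Rmult_le_compat_r.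
  { apply Rlt_le, Rinv_0_lt_compat, gauss_denominator_pos. }
  generalize (S n). clear n. intros n. induction n as [|n IH].
  - apply Rle_refl.
  - rewrite !rising_S, !Cmod_mult.
    apply Rmult_le_compat; try apply Cmod_ge_0; trivial.
    rewrite <- RtoC_plus, Cmod_R.
    replace (Re z + INR n)%R with (Re (z + INR n)) by reflexivity.
    apply re_le_Cmod.
Qed.

Lemma inv_square_telescope (s : R) (n : nat) :
  (0 < s)%R ->
  (/ (s + INR (S n)) ^ 2 <= / (s + INR n) - / (s + INR (S n)))%R.
Proof.
  intros Hs. rewrite S_INR. assert (Hn := pos_INR n).
  replace (/ (s + INR n) - / (s + (INR n + 1)))%R
    with (/ (s + INR n) * / (s + (INR n + 1)))%R by (field; lra).
  simpl. rewrite Rmult_1_r, Rinv_mult.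
  apply Rmult_le_compat_r; [apply Rlt_le, Rinv_0_lt_compat; lra|].
  apply Rinv_le_contravar; lra.
Qed.

(** Each factor of [Gamma z / Gamma (z + i tau)] satisfies
    [|1 + i tau / (z + k)| ^ 2 <= 1 + A / (s + k) ^ 2] with
    [s = Re z + |Im z|] and [A = O(s)], and the sum over [k] of
    [(s + k) ^ -2] is [O(1 / s)]: the bound does not depend on [Im z]. *)
Lemma Cmod_rGamma_vertical_shift (x0 tau : R) :
  (0 < x0)%R ->
  exists K : R, (0 < K)%R /\ forall z : C, (x0 <= Re z)%R ->
    (Cmod (rGamma (z + Ci * tau)) <= K * Cmod (rGamma z))%R.
Proof.
  intros Hx0.
  set (t := Rabs tau).
  set (B := (2 * (2 * t + t ^ 2 / x0) * (/ x0 + 1))%R).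
  exists (exp (B / 2)). split; [apply exp_pos|]. intros z Hz.
  set (s := (Re z + Rabs (Im z))%R).
  assert (Hy := Rabs_pos (Im z)). assert (Ht : (0 <= t)%R) by apply Rabs_pos.
  assert (Hs : (x0 <= s)%R) by (unfold s; lra).
  set (A := (2 * (2 * t * s + t ^ 2))%R).
  assert (HA : (0 <= A)%R) by (unfold A; nra).
  assert (F : forall k, (Cmod (z + Ci * tau + INR k) ^ 2 <=
    Cmod (z + INR k) ^ 2 * exp (A * / (s + INR k) ^ 2))%R).
  { intros k. assert (Hk := pos_INR k).
    assert (P : (0 < (s + INR k) ^ 2)%R) by (apply pow_lt; lra).
    apply Rle_trans with (Cmod (z + INR k) ^ 2 * (1 + A * / (s + INR k) ^ 2))%R.
    2: { apply Rmult_le_compat_l; [apply pow2_ge_0 | apply exp_ineq1_le]. }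
    rewrite !Cmod2_alt.
    replace (Re (z + Ci * tau + INR k)) with (Re z + INR k)%R
      by (unfold Re; simpl; ring).
    replace (Im (z + Ci * tau + INR k)) with (Im z + tau)%R
      by (unfold Im; simpl; ring).
    replace (Re (z + INR k)) with (Re z + INR k)%R by (unfold Re; simpl; ring).
    replace (Im (z + INR k)) with (Im z)%R by (unfold Im; simpl; ring).
    set (X := (Re z + INR k)%R). set (Y := Im z) in *.
    assert (HX : (0 <= X)%R) by (unfold X; lra).
    assert (H1 : ((s + INR k) ^ 2 <= 2 * (X ^ 2 + Y ^ 2))%R).
    { replace (s + INR k)%R with (X + Rabs Y)%R by (unfold s, X; ring).
      assert (Q := pow2_abs Y). assert (Q2 := pow2_ge_0 (X - Rabs Y)). nra. }
    assert (H2 : (2 * tau * Y + tau ^ 2 <= A / 2)%R).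
    { assert (Q := Rle_abs (tau * Y)). rewrite Rabs_mult in Q. fold t in Q.
      assert (Q2 := pow2_abs tau). fold t in Q2. unfold A.
      assert (Rabs Y <= s)%R by (unfold s; fold Y; lra). nra. }
    assert (H3 : (A / 2 <= (X ^ 2 + Y ^ 2) * (A * / (s + INR k) ^ 2))%R).
    { apply (Rmult_le_reg_r ((s + INR k) ^ 2)); trivial.
      replace ((X ^ 2 + Y ^ 2) * (A * / (s + INR k) ^ 2) * (s + INR k) ^ 2)%R
        with ((X ^ 2 + Y ^ 2) * A)%R by (field; lra). nra. }
    nra. }
  apply Cmod_rGamma_le with (fun _ => exp (B / 2)); [|apply is_lim_seq_const].
  exists O. intros n _. rewrite !Cmod_rGamma_seq.
  replace (Re (z + Ci * tau)) with (Re z) by (unfold Re; simpl; ring).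
  match goal with |- (_ <= ?e * (?x / ?d))%R =>
    replace (e * (x / d))%R with (e * x / d)%R by (unfold Rdiv; ring) end.
  apply Rmult_le_compat_r.
  { apply Rlt_le, Rinv_0_lt_compat, gauss_denominator_pos. }
  assert (I : (Cmod (rising (z + Ci * tau) (S n)) ^ 2 <=
    Cmod (rising z (S n)) ^ 2 * exp (A * (/ s ^ 2 + / s - / (s + INR n))))%R).
  { induction n as [|n IH].
    - rewrite !rising_S. unfold rising; simpl Cprod. rewrite !Cmult_1_l.
      eapply Rle_trans; [apply F|]. simpl (INR 0). rewrite !Rplus_0_r.
      apply Req_le. f_equal. f_equal. ring.
    - rewrite (rising_S _ (S n)), (rising_S z (S n)), !Cmod_mult, !Rpow_mult_distr.
      eapply Rle_trans.
      { apply Rmult_le_compat; [apply pow2_ge_0 | apply pow2_ge_0 | apply IH | apply F]. }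
      match goal with |- (?a * ?b * (?c * ?d) <= _)%R =>
        replace (a * b * (c * d))%R with (a * c * (b * d))%R by ring end.
      rewrite <- exp_plus.
      apply Rmult_le_compat_l; [apply Rmult_le_pos; apply pow2_ge_0|].
      apply exp_le. assert (T := inv_square_telescope s n ltac:(lra)). nra. }
  apply Rsqr_incr_0; [|apply Cmod_ge_0|].
  2: { apply Rmult_le_pos; [apply Rlt_le, exp_pos | apply Cmod_ge_0]. }
  rewrite !Rsqr_pow2, Rpow_mult_distr, Rmult_comm.
  replace (exp (B / 2) ^ 2)%R with (exp B).
  2: { simpl. rewrite Rmult_1_r, <- exp_plus. f_equal. field. }
  eapply Rle_trans; [apply I|]. apply Rmult_le_compat_l; [apply pow2_ge_0|].
  apply exp_le.
  assert (Hn := pos_INR n).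
  assert (P1 : (0 < / (s + INR n))%R) by (apply Rinv_0_lt_compat; lra).
  apply Rle_trans with (A * (/ s ^ 2 + / s))%R; [apply Rmult_le_compat_l; lra|].
  replace (A * (/ s ^ 2 + / s))%R with (2 * (2 * t + t ^ 2 / s) * (/ s + 1))%R
    by (unfold A; field; lra).
  assert (P2 : (/ s <= / x0)%R) by (apply Rinv_le_contravar; lra).
  assert (P3 : (0 < / s)%R) by (apply Rinv_0_lt_compat; lra).
  assert (P4 := pow2_ge_0 t).
  assert (P5 : (t ^ 2 * / s <= t ^ 2 * / x0)%R) by (apply Rmult_le_compat_l; lra).
  assert (P6 : (0 <= t ^ 2 * / s)%R) by (apply Rmult_le_pos; lra).
  unfold B, Rdiv. apply Rmult_le_compat; lra.
Qed.

Lemma ln_le_sub_1 (x : R) : (0 < x)%R -> (ln x <= x - 1)%R.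
Proof.
  intros H. assert (E := exp_ineq1_le (ln x)). rewrite exp_ln in E by trivial. lra.
Qed.

Lemma Cmod_RtoC_pos (x : R) : (0 <= x)%R -> Cmod (RtoC x) = x.
Proof. intros H. rewrite Cmod_R. now apply Rabs_pos_eq. Qed.

(** [Gamma s / Gamma (s + d)] is the limit of
    [n ^ (- d)] times the product of the [1 + d / (s + k) <= exp (d / (s + k))],
    and the harmonic sum of the [1 / (s + k)] is at most
    [1 / s + ln ((s + n) / s)]. *)
Lemma Cmod_rGamma_add_le (s d : R) :
  (0 < s)%R -> (0 <= d)%R ->
  (Cmod (rGamma (RtoC (s + d))) <=
    exp (d / s) * exp (- (d * ln s)) * Cmod (rGamma (RtoC s)))%R.
Proof.
  intros Hs Hd.
  assert (I : forall n, (Cmod (rising (RtoC (s + d)) (S n)) <=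
    Cmod (rising (RtoC s) (S n)) * exp (d * (/ s + ln (s + INR n) - ln s)))%R).
  { assert (F : forall k, (Cmod (RtoC (s + d) + INR k) <=
      Cmod (RtoC s + INR k) * exp (d * / (s + INR k)))%R).
    { intros k. assert (Hk := pos_INR k).
      rewrite <- !RtoC_plus, !Cmod_RtoC_pos by lra.
      apply Rle_trans with ((s + INR k) * (1 + d * / (s + INR k)))%R.
      - apply Req_le. field. lra.
      - apply Rmult_le_compat_l; [lra | apply exp_ineq1_le]. }
    intros n. induction n as [|n IH].
    - rewrite !rising_S. unfold rising; simpl Cprod. rewrite !Cmult_1_l.
      eapply Rle_trans; [apply F|]. simpl (INR 0). rewrite !Rplus_0_r.
      apply Req_le. f_equal. f_equal. ring.
    - rewrite (rising_S _ (S n)), (rising_S (RtoC s) (S n)), !Cmod_mult.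
      eapply Rle_trans.
      { apply Rmult_le_compat; [apply Cmod_ge_0 | apply Cmod_ge_0 | apply IH | apply F]. }
      match goal with |- (?a * ?b * (?c * ?d) <= _)%R =>
        replace (a * b * (c * d))%R with (a * c * (b * d))%R by ring end.
      rewrite <- exp_plus.
      apply Rmult_le_compat_l; [apply Rmult_le_pos; apply Cmod_ge_0|].
      apply exp_le. assert (Hn := pos_INR n). rewrite S_INR.
      assert (L := ln_le_sub_1 ((s + INR n) * / (s + (INR n + 1)))%R
        ltac:(apply Rmult_lt_0_compat; [lra | apply Rinv_0_lt_compat; lra])).
      rewrite ln_mult, ln_Rinv in L; try lra.
      2: apply Rinv_0_lt_compat; lra.
      replace ((s + INR n) * / (s + (INR n + 1)) - 1)%R
        with (- / (s + (INR n + 1)))%R in L by (field; lra).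
      nra. }
  apply Cmod_rGamma_le with
    (fun n => exp (d / s) * exp (- (d * ln s)) * exp (d * s * / INR n))%R.
  - exists 1%nat. intros n Hn.
    assert (Hn' : (0 < INR n)%R) by (apply lt_0_INR; lia).
    rewrite !Cmod_rGamma_seq.
    match goal with |- (_ <= ?e * (?x / ?d))%R =>
      replace (e * (x / d))%R with (e * x / d)%R by (unfold Rdiv; ring) end.
    apply Rle_div_l; [apply gauss_denominator_pos|].
    eapply Rle_trans; [apply I|].
    simpl (Re (RtoC _)). rewrite Rmult_plus_distr_r, exp_plus.
    replace (exp (s * ln (INR n))) with (/ / exp (s * ln (INR n)))%R
      by apply Rinv_inv.
    match goal with |- (?x * ?e <= ?a * ?b * ?c * ?y / (?f * / ?g) * (?f * (/ ?g * ?h)))%R =>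
      replace (a * b * c * y / (f * / g) * (f * (/ g * h)))%R
        with (y * (a * b * c * h))%R end.
    2: { field. repeat split; try apply INR_fact_neq_0;
         try apply Rinv_neq_0_compat; apply Rgt_not_eq, exp_pos. }
    apply Rmult_le_compat_l; [apply Cmod_ge_0|].
    rewrite <- !exp_plus. apply exp_le.
    assert (L := ln_le_sub_1 ((s + INR n) * / INR n)%R
        ltac:(apply Rmult_lt_0_compat; [lra | apply Rinv_0_lt_compat; lra])).
    rewrite ln_mult, ln_Rinv in L; try lra.
    2: apply Rinv_0_lt_compat; lra.
    replace ((s + INR n) * / INR n - 1)%R with (s * / INR n)%R in L by (field; lra).
    unfold Rdiv. nra.
  - replace (Finite (exp (d / s) * exp (- (d * ln s)))) with
      (Finite (exp (d / s) * exp (- (d * ln s)) * exp (d * s * 0)))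
      by (f_equal; rewrite Rmult_0_r, exp_0; ring).
    apply is_lim_seq_mult'; [apply is_lim_seq_const|].
    apply (is_lim_seq_continuous exp (fun n => d * s * / INR n)%R (d * s * 0)%R).
    + apply derivable_continuous_pt, derivable_pt_exp.
    + apply is_lim_seq_mult'; [apply is_lim_seq_const | apply is_lim_seq_inv_INR].
Qed.

(** Here [1 + q / (s + k)] is bounded below, by
    [exp (q / (s + q + k)) >= ((s + q + k + 1) / (s + q + k)) ^ q], whose product
    telescopes. *)
Lemma Cmod_rGamma_add_ge (s q : R) :
  (0 < s)%R -> (0 <= q)%R ->
  (Cmod (rGamma (RtoC s)) <=
    exp (q * ln (s + q)) * Cmod (rGamma (RtoC (s + q))))%R.
Proof.
  intros Hs Hq.
  assert (I : forall n, (Cmod (rising (RtoC s) n) *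
    exp (q * (ln (s + q + INR n) - ln (s + q))) <= Cmod (rising (RtoC (s + q)) n))%R).
  { intros n. induction n as [|n IH].
    - simpl (INR 0). rewrite Rplus_0_r, Rminus_diag, Rmult_0_r, exp_0, Rmult_1_r.
      apply Rle_refl.
    - rewrite !rising_S, !Cmod_mult. assert (Hn := pos_INR n).
      rewrite <- !RtoC_plus, (Cmod_RtoC_pos (s + INR n)),
        (Cmod_RtoC_pos (s + q + INR n)) by lra.
      apply Rle_trans with (Cmod (rising (RtoC s) n) *
        exp (q * (ln (s + q + INR n) - ln (s + q))) * (s + q + INR n))%R.
      2: apply Rmult_le_compat_r; lra.
      rewrite S_INR.
      replace (q * (ln (s + q + (INR n + 1)) - ln (s + q)))%R with
        (q * (ln (s + q + INR n) - ln (s + q)) +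
         q * (ln (s + q + (INR n + 1)) - ln (s + q + INR n)))%R by ring.
      rewrite exp_plus, !Rmult_assoc.
      apply Rmult_le_compat_l; [apply Cmod_ge_0|].
      rewrite (Rmult_comm (s + INR n)), Rmult_assoc.
      apply Rmult_le_compat_l; [apply Rlt_le, exp_pos|].
      set (t := (s + q + INR n)%R).
      assert (Ht : (0 < t)%R) by (unfold t; lra).
      replace (s + q + (INR n + 1))%R with (t + 1)%R by (unfold t; ring).
      assert (L := ln_le_sub_1 ((t + 1) * / t)%R
        ltac:(apply Rmult_lt_0_compat; [lra | apply Rinv_0_lt_compat; lra])).
      rewrite ln_mult, ln_Rinv in L; try lra.
      2: apply Rinv_0_lt_compat; lra.
      replace ((t + 1) * / t - 1)%R with (/ t)%R in L by (field; lra).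
      apply Rle_trans with (exp (q * / t) * (s + INR n))%R.
      { apply Rmult_le_compat_r; [lra|]. apply exp_le, Rmult_le_compat_l; lra. }
      assert (E := exp_ineq1_le (- (q * / t))). rewrite exp_Ropp in E.
      replace (1 + - (q * / t))%R with ((s + INR n) * / t)%R in E
        by (unfold t in *; field; lra).
      apply (Rmult_le_reg_l (/ t)); [now apply Rinv_0_lt_compat|].
      replace (/ t * t)%R with 1%R by (field; lra).
      rewrite <- (Rinv_r (exp (q * / t))) by apply Rgt_not_eq, exp_pos.
      replace (/ t * (exp (q * / t) * (s + INR n)))%R
        with (exp (q * / t) * ((s + INR n) * / t))%R by ring.
      apply Rmult_le_compat_l; [apply Rlt_le, exp_pos | exact E]. }
  apply Cmod_rGamma_le with (fun n => exp (q * ln (s + q))); [|apply is_lim_seq_const].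
  exists 1%nat. intros n Hn.
  assert (Hn' : (0 < INR n)%R) by (apply lt_0_INR; lia).
  rewrite !Cmod_rGamma_seq.
  match goal with |- (_ <= ?e * (?x / ?d))%R =>
    replace (e * (x / d))%R with (e * x / d)%R by (unfold Rdiv; ring) end.
  apply Rle_div_l; [apply gauss_denominator_pos|].
  specialize (I (S n)).
  simpl (Re (RtoC _)). rewrite (Rmult_plus_distr_r s q), exp_plus.
  match goal with |- (_ <= ?a * ?y / (?f * (?g * ?h)) * (?f * ?g))%R =>
    replace (a * y / (f * (g * h)) * (f * g))%R with (y * (a * / h))%R end.
  2: { field. repeat split; try apply INR_fact_neq_0; apply Rgt_not_eq, exp_pos. }
  rewrite <- exp_Ropp, <- exp_plus.
  assert (L : (ln (INR n) <= ln (s + q + INR (S n)))%R).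
  { apply ln_le; [trivial|]. rewrite S_INR. lra. }
  apply Rle_trans with (Cmod (rising (RtoC (s + q)) (S n)) *
    exp (- (q * (ln (s + q + INR (S n)) - ln (s + q)))))%R.
  - rewrite exp_Ropp. apply Rle_div_r; [apply exp_pos | exact I].
  - apply Rmult_le_compat_l; [apply Cmod_ge_0|]. apply exp_le. nra.
Qed.

Lemma ex_series_ratio (a rho : nat -> R) :
  (forall n, 0 <= a n)%R -> (forall n, a (S n) <= rho n * a n)%R ->
  is_lim_seq rho 0 -> ex_series a.
Proof.
  intros Ha Hr Hl.
  apply (is_lim_seq_spec _ 0) in Hl.
  destruct (Hl (mkposreal (/ 2) ltac:(lra))) as [N HN]. simpl in HN.
  apply (ex_series_incr_n (V := R_NormedModule) a N).
  apply (ex_series_le (V := R_CompleteNormedModule) _ (fun n => a N * (/ 2) ^ n)%R).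
  - intros n. unfold norm; simpl norm. unfold abs; simpl abs.
    rewrite Rabs_pos_eq by apply Ha.
    induction n as [|n IH].
    + rewrite Nat.add_0_r. simpl. lra.
    + rewrite Nat.add_succ_r. simpl.
      assert (H := HN (N + n)%nat ltac:(lia)). rewrite Rminus_0_r in H.
      assert (H1 := Rle_abs (rho (N + n)%nat)).
      assert (H2 := Hr (N + n)%nat). assert (H3 := Ha (N + n)%nat). nra.
  - apply (ex_series_scal (V := R_NormedModule)), ex_series_geom.
    rewrite Rabs_pos_eq; lra.
Qed.

Lemma is_lim_seq_exp_ln_neg (p : R) :
  (0 < p)%R -> is_lim_seq (fun n => exp (- p * ln (INR (n + 2)))) 0.
Proof.
  intros Hp.
  apply (is_lim_comp_seq exp _ m_infty 0).
  - apply is_lim_exp_m.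
  - exists O. intros n _. discriminate.
  - replace m_infty with (Rbar_mult (- p)%R p_infty).
    + apply (is_lim_seq_scal_l (fun n => ln (INR (n + 2))) (- p) p_infty).
      apply (is_lim_comp_seq ln _ p_infty p_infty).
      * apply is_lim_ln_p.
      * exists O. intros n _. discriminate.
      * apply (is_lim_seq_incr_n INR 2), is_lim_seq_INR.
    + apply is_Rbar_mult_unique, is_Rbar_mult_sym, is_Rbar_mult_p_infty_neg.
      simpl. lra.
Qed.

Lemma Cmod_rGamma_vertical_shifts (x0 tau : R) :
  (0 < x0)%R ->
  exists K : R, (0 < K)%R /\ forall (z : C) (n : nat), (x0 <= Re z)%R ->
    (Cmod (rGamma (z + Ci * (tau * INR n))) <= K ^ n * Cmod (rGamma z))%R.
Proof.
  intros Hx0. destruct (Cmod_rGamma_vertical_shift x0 tau Hx0) as [K [HK H]].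
  exists K. split; trivial. intros z n Hz. induction n as [|n IH].
  - simpl. rewrite Rmult_1_l. apply Req_le. do 2 f_equal. ring.
  - rewrite S_INR, RtoC_plus.
    replace (z + Ci * (tau * (INR n + 1)))
      with (z + Ci * (tau * INR n) + Ci * tau) by ring.
    eapply Rle_trans; [apply H|].
    + replace (Re (z + Ci * (tau * INR n))) with (Re z); [trivial|].
      unfold Re; simpl; ring.
    + simpl. rewrite Rmult_assoc. apply Rmult_le_compat_l; lra.
Qed.

Lemma Cmod_Gamma_Re (z : C) :
  (0 < Re z)%R -> (Cmod (Gamma z) <= Cmod (Gamma (RtoC (Re z))))%R.
Proof.
  intros H. unfold Gamma.
  assert (H1 : rGamma z <> 0) by now apply rGamma_neq_0_Re.
  assert (H2 : rGamma (RtoC (Re z)) <> 0) by now apply rGamma_neq_0_Re.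
  rewrite !Cmod_inv by trivial.
  apply Rinv_le_contravar; [now apply Cmod_gt_0 | apply Cmod_rGamma_Re; lra].
Qed.

Lemma Cmod_Gamma_add_le (s q : R) :
  (0 < s)%R -> (0 <= q)%R ->
  (Cmod (Gamma (RtoC (s + q))) <= exp (q * ln (s + q)) * Cmod (Gamma (RtoC s)))%R.
Proof.
  intros Hs Hq. unfold Gamma.
  assert (H1 : rGamma (RtoC s) <> 0) by now apply rGamma_neq_0_Re.
  assert (H2 : rGamma (RtoC (s + q)) <> 0) by (apply rGamma_neq_0_Re; simpl; lra).
  assert (H := Cmod_rGamma_add_ge s q Hs Hq).
  apply Cmod_gt_0 in H1 as P1, H2 as P2.
  rewrite !Cmod_inv by trivial.
  apply (Rmult_le_reg_l (Cmod (rGamma (s + q)%R) * Cmod (rGamma s))).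
  { now apply Rmult_lt_0_compat. }
  replace (Cmod (rGamma (s + q)%R) * Cmod (rGamma s) * / Cmod (rGamma (s + q)%R))%R
    with (Cmod (rGamma s)) by (field; lra).
  replace (Cmod (rGamma (s + q)%R) * Cmod (rGamma s) * (exp (q * ln (s + q)) * / Cmod (rGamma s)))%R
    with (exp (q * ln (s + q)) * Cmod (rGamma (s + q)%R))%R by (field; lra).
  exact H.
Qed.

(** [Gamma (g + q n) / (n! Gamma (x + d n))] behaves like [n ^ ((q - 1 - d) n)]
    up to a geometric factor, hence the condition on [q]. *)
Lemma ex_series_Gamma_quotient (g q x d r : R) :
  (0 <= g)%R -> (0 < q)%R -> (0 < x)%R -> (0 <= d)%R -> (q < 1 + d)%R -> (0 <= r)%R ->
  ex_series (fun n => Cmod (Gamma (RtoC (g + q * INR (n + 1))))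
    * Cmod (rGamma (RtoC (x + d * INR (n + 1))))
    / INR (fact (n + 1)) * r ^ (n + 1))%R.
Proof.
  intros Hg Hq Hx Hd Hqd Hr.
  (* [x + d (n + 1) >= c (n + 2)] with [c = min x d]; if [d = 0] the logarithm of
     the left-hand side is multiplied by [0] and any [c] will do. *)
  assert (Hc : exists c, (0 < c)%R /\ forall n,
    (- (d * ln (x + d * INR (n + 1))) <= - (d * ln c) - d * ln (INR (n + 2)))%R).
  { destruct Hd as [Hd|<-].
    - exists (Rmin x d).
      assert (Hc : (0 < Rmin x d)%R) by now apply Rmin_pos.
      split; [trivial|]. intros n. rewrite !plus_INR. simpl (INR 1). simpl (INR 2).
      assert (Hn := pos_INR n).
      assert (L : (ln (Rmin x d * (INR n + 2)) <= ln (x + d * (INR n + 1)))%R).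
      { apply ln_le; [apply Rmult_lt_0_compat; lra|].
        assert (H1 := Rmin_l x d). assert (H2 := Rmin_r x d). nra. }
      rewrite ln_mult in L by lra. replace (1 + 1)%R with 2%R by ring. nra.
    - exists 1%R. split; [lra|]. intros n. lra. }
  destruct Hc as [c [Hc0 Hc]].
  set (M := (exp (q * ln (g + q)) * exp (d / x) * exp (- (d * ln c)) * r)%R).
  apply ex_series_ratio with
    (fun n => M * exp (- (1 + d - q) * ln (INR (n + 2))))%R.
  - intros n. apply Rmult_le_pos; [|now apply pow_le].
    apply Rmult_le_pos; [apply Rmult_le_pos; apply Cmod_ge_0|].
    apply Rlt_le, Rinv_0_lt_compat, INR_fact_lt_0.
  - intros n. assert (Hn := pos_INR n).
    replace (S n + 1)%nat with (S (n + 1)) by lia.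
    set (N := INR (n + 1)).
    assert (HN : (1 <= N)%R) by (unfold N; rewrite plus_INR; simpl; lra).
    replace (INR (S (n + 1))) with (N + 1)%R by (unfold N; now rewrite S_INR).
    assert (G := Cmod_Gamma_add_le (g + q * N) q ltac:(nra) ltac:(lra)).
    assert (V := Cmod_rGamma_add_le (x + d * N) d ltac:(nra) Hd).
    replace (g + q * N + q)%R with (g + q * (N + 1))%R in G by ring.
    replace (x + d * N + d)%R with (x + d * (N + 1))%R in V by ring.
    replace (fact (S (n + 1))) with (S (n + 1) * fact (n + 1))%nat by reflexivity.
    rewrite mult_INR.
    replace (INR (S (n + 1))) with (N + 1)%R by (unfold N; now rewrite S_INR).
    replace (n + 2)%nat with (S (n + 1)) by lia.
    replace (INR (S (n + 1))) with (N + 1)%R by (unfold N; now rewrite S_INR).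
    set (A := Cmod (Gamma (RtoC (g + q * N)))) in *.
    set (A' := Cmod (Gamma (RtoC (g + q * (N + 1))))) in *.
    set (B := Cmod (rGamma (RtoC (x + d * N)))) in *.
    set (B' := Cmod (rGamma (RtoC (x + d * (N + 1))))) in *.
    assert (A0 : (0 <= A)%R) by apply Cmod_ge_0.
    assert (B0 : (0 <= B)%R) by apply Cmod_ge_0.
    assert (A'0 : (0 <= A')%R) by apply Cmod_ge_0.
    assert (B'0 : (0 <= B')%R) by apply Cmod_ge_0.
    assert (GA : (A' <= exp (q * ln (g + q)) * exp (q * ln (N + 1)) * A)%R).
    { eapply Rle_trans; [exact G|]. apply Rmult_le_compat_r; trivial.
      rewrite <- exp_plus. apply exp_le.
      assert (L : (ln (g + q * (N + 1)) <= ln ((g + q) * (N + 1)))%R)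
        by (apply ln_le; nra).
      rewrite ln_mult in L by lra. nra. }
    assert (GB : (B' <= exp (d / x) * exp (- (d * ln c)) * exp (- (d * ln (N + 1))) * B)%R).
    { eapply Rle_trans; [exact V|]. apply Rmult_le_compat_r; trivial.
      rewrite <- !exp_plus. apply exp_le.
      assert (L := Hc n). fold N in L.
      replace (n + 2)%nat with (S (n + 1)) in L by lia.
      replace (INR (S (n + 1))) with (N + 1)%R in L by (unfold N; now rewrite S_INR).
      assert (L2 : (d / (x + d * N) <= d / x)%R).
      { apply Rmult_le_compat_l; trivial. apply Rinv_le_contravar; nra. }
      lra. }
    replace (- (1 + d - q) * ln (N + 1))%R with
      (q * ln (N + 1) + - (d * ln (N + 1)) + - ln (N + 1))%R by ring.
    rewrite !exp_plus, (exp_Ropp (ln _)), exp_ln by lra.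
    assert (F0 := INR_fact_lt_0 (n + 1)).
    assert (R0 : (0 <= r ^ (n + 1))%R) by now apply pow_le.
    replace (A' * B' / ((N + 1) * INR (fact (n + 1))) * r ^ S (n + 1))%R
      with (A' * B' * (r ^ (n + 1) * r / ((N + 1) * INR (fact (n + 1)))))%R
      by (simpl; field; lra).
    eapply Rle_trans.
    { apply Rmult_le_compat_r; [|apply (Rmult_le_compat _ _ _ _ A'0 B'0 GA GB)].
      apply Rmult_le_pos; [now apply Rmult_le_pos|].
      apply Rlt_le, Rinv_0_lt_compat, Rmult_lt_0_compat; lra. }
    apply Req_le. unfold M. field. lra.
  - replace (Finite 0) with (Finite (M * 0)) by (f_equal; ring).
    apply is_lim_seq_mult'; [apply is_lim_seq_const|].
    apply is_lim_seq_exp_ln_neg. lra.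
Qed.

Definition bessel_maitland_coeff (delta gam v : C) (q : R) (n : nat) : C :=
  pochhammer gam (q * INR n) * (- (1)) ^ n / INR (fact n)
  * rGamma (delta * INR n + v + 1).

Lemma bessel_maitland_term_coeff (delta gam v z : C) (q : R) (n : nat) :
  bessel_maitland_term delta gam v q z n
  = bessel_maitland_coeff delta gam v q n * z ^ n.
Proof.
  unfold bessel_maitland_term, bessel_maitland_coeff.
  replace (- z) with (- (1) * z) by ring. rewrite Cpow_mult_l.
  unfold Cdiv. ring.
Qed.

(** [|Gamma (gam + q n)|] is at most its value at the real part. The argument
    [v + 1 + delta n] of [1 / Gamma] is reached from its real part by one shift by
    [i Im v] and [n] shifts by [i Im delta], each costing a bounded factor. *)
Lemma ex_series_bessel_maitland_coeff (delta gam v : C) (q r : R) :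
  (0 <= Re gam)%R -> (0 < q)%R -> (-1 < Re v)%R -> (0 <= Re delta)%R ->
  (-1 < Re delta - q)%R -> (0 <= r)%R ->
  ex_series (fun n => Cmod (bessel_maitland_coeff delta gam v q n) * r ^ n)%R.
Proof.
  intros Hg Hq Hv Hd Hdq Hr.
  set (x := (Re v + 1)%R). set (d := Re delta). set (g := Re gam).
  assert (Hx : (0 < x)%R) by (unfold x; lra).
  destruct (Cmod_rGamma_vertical_shift x (Im v) Hx) as [K1 [HK1 V1]].
  destruct (Cmod_rGamma_vertical_shifts x (Im delta) Hx) as [K [HK V]].
  apply (ex_series_incr_1 (V := R_NormedModule)).
  apply (ex_series_le (V := R_CompleteNormedModule) _ (fun n =>
    Cmod (/ Gamma gam) * K1 * (Cmod (Gamma (RtoC (g + q * INR (n + 1))))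
    * Cmod (rGamma (RtoC (x + d * INR (n + 1))))
    / INR (fact (n + 1)) * (K * r) ^ (n + 1)))%R).
  2: { apply (ex_series_scal (V := R_NormedModule)).
       apply ex_series_Gamma_quotient; unfold g, d; try lra.
       apply Rmult_le_pos; lra. }
  intros n. unfold norm; simpl norm. unfold abs; simpl abs.
  rewrite Rabs_pos_eq by (apply Rmult_le_pos; [apply Cmod_ge_0 | now apply pow_le]).
  replace (n + 1)%nat with (S n) by lia. set (N := INR (S n)).
  assert (HN : (1 <= N)%R).
  { unfold N. rewrite S_INR. assert (H := pos_INR n). lra. }
  unfold bessel_maitland_coeff, pochhammer. fold N.
  destruct (Req_EM_T (q * N) 0) as [E|_]; [nra|].
  unfold Cdiv. rewrite !Cmod_mult, Cmod_pow, Cmod_m1, pow1, Rmult_1_r.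
  rewrite (Cmod_inv (INR (fact (S n)))), Cmod_RtoC_pos
    by (apply INR_fact_neq_0_C || apply pos_INR).
  assert (B1 : (Cmod (Gamma (gam + (q * N)%R)) <= Cmod (Gamma (RtoC (g + q * N))))%R).
  { apply (Cmod_Gamma_Re (gam + (q * N)%R)). simpl. fold (Re gam). nra. }
  assert (B2 : (Cmod (rGamma (delta * N + v + 1)) <=
    K ^ S n * (K1 * Cmod (rGamma (RtoC (x + d * N)))))%R).
  { assert (Hz : (x <= Re (RtoC (x + d * N)))%R) by (simpl; unfold d; nra).
    replace (delta * N + v + 1) with
      (RtoC (x + d * N) + Ci * Im v + Ci * (Im delta * N)).
    - eapply Rle_trans; [apply V|].
      + replace (Re (RtoC (x + d * N) + Ci * Im v)) with (Re (RtoC (x + d * N)))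
          by (unfold Re; simpl; ring). exact Hz.
      + apply Rmult_le_compat_l; [apply pow_le; lra | now apply V1].
    - unfold x, d. destruct delta, v.
      unfold Ci, RtoC, Cplus, Cmult, Re, Im; simpl. f_equal; ring. }
  rewrite Rpow_mult_distr.
  assert (F0 := INR_fact_lt_0 (S n)).
  apply Rle_trans with (Cmod (Gamma (RtoC (g + q * N))) * Cmod (/ Gamma gam)
    * / INR (fact (S n)) * (K ^ S n * (K1 * Cmod (rGamma (RtoC (x + d * N))))) * r ^ S n)%R.
  - apply Rmult_le_compat_r; [now apply pow_le|].
    apply Rmult_le_compat; trivial; try apply Cmod_ge_0.
    + apply Rmult_le_pos; [apply Rmult_le_pos; apply Cmod_ge_0|].
      now apply Rlt_le, Rinv_0_lt_compat.
    + apply Rmult_le_compat_r; [now apply Rlt_le, Rinv_0_lt_compat|].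
      apply Rmult_le_compat_r; [apply Cmod_ge_0 | exact B1].
  - apply Req_le. unfold Rdiv. ring.
Qed.

(** * Integrals of complex functions *)

Definition Ccontinuous (f : R -> C) (x : R) : Prop :=
  continuous (fun t => Re (f t)) x /\ continuous (fun t => Im (f t)) x.

Lemma Ccontinuous_mult (f g : R -> C) (x : R) :
  Ccontinuous f x -> Ccontinuous g x -> Ccontinuous (fun t => f t * g t) x.
Proof.
  intros [F1 F2] [G1 G2]. split; unfold Cmult, Re, Im in *; simpl fst; simpl snd.
  - apply (continuous_minus (V := R_NormedModule));
      apply (continuous_mult (K := R_AbsRing)); assumption.
  - apply (continuous_plus (V := R_NormedModule));
      apply (continuous_mult (K := R_AbsRing)); assumption.
Qed.

Lemma Ccontinuous_plus (f g : R -> C) (x : R) :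
  Ccontinuous f x -> Ccontinuous g x -> Ccontinuous (fun t => f t + g t) x.
Proof.
  intros [F1 F2] [G1 G2].
  split; apply (continuous_plus (V := R_NormedModule)); assumption.
Qed.

Lemma Ccontinuous_locally (f : R -> C) (x eps : R) :
  (0 < eps)%R -> Ccontinuous f x -> locally x (fun t => (Cmod (f t - f x) < eps)%R).
Proof.
  intros He [F1 F2].
  assert (He2 : (0 < eps / 2)%R) by lra.
  assert (H1 := proj1 (filterlim_locally _ _) F1 (mkposreal _ He2)).
  assert (H2 := proj1 (filterlim_locally _ _) F2 (mkposreal _ He2)).
  generalize (filter_and _ _ H1 H2). apply filter_imp. intros t [B1 B2].
  change (Rabs (Re (f t) - Re (f x)) < eps / 2)%R in B1.
  change (Rabs (Im (f t) - Im (f x)) < eps / 2)%R in B2.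
  eapply Rle_lt_trans; [apply Cmod_le_Re_Im|].
  change (Re (f t - f x)) with (Re (f t) - Re (f x))%R.
  change (Im (f t - f x)) with (Im (f t) - Im (f x))%R.
  lra.
Qed.

Notation is_CInt := (is_RInt (V := C_R_NormedModule)).
Notation ex_CInt := (ex_RInt (V := C_R_NormedModule)).
Notation is_CInt_gen := (is_RInt_gen (V := C_R_NormedModule)).

Lemma is_CInt_Re_Im (f : R -> C) (a b : R) (l : C) :
  is_CInt f a b l <-> is_RInt (fun t => Re (f t)) a b (Re l) /\
                      is_RInt (fun t => Im (f t)) a b (Im l).
Proof.
  split.
  - intros H. split.
    + exact (is_RInt_fct_extend_fst (U := R_NormedModule) (V := R_NormedModule) f a b l H).
    + exact (is_RInt_fct_extend_snd (U := R_NormedModule) (V := R_NormedModule) f a b l H).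
  - intros [H1 H2]. rewrite (surjective_pairing l).
    exact (is_RInt_fct_extend_pair (U := R_NormedModule) (V := R_NormedModule)
      f a b _ _ H1 H2).
Qed.

Lemma ex_CInt_continuous (f : R -> C) (a b : R) :
  (forall x, (Rmin a b <= x <= Rmax a b)%R -> Ccontinuous f x) -> ex_CInt f a b.
Proof.
  intros H.
  destruct (ex_RInt_continuous (V := R_CompleteNormedModule) (fun t => Re (f t)) a b) as [l1 H1].
  { intros x Hx. exact (proj1 (H x Hx)). }
  destruct (ex_RInt_continuous (V := R_CompleteNormedModule) (fun t => Im (f t)) a b) as [l2 H2].
  { intros x Hx. exact (proj2 (H x Hx)). }
  exists (l1, l2). exact (proj2 (is_CInt_Re_Im f a b (l1, l2)) (conj H1 H2)).
Qed.

Lemma is_CInt_mult_l (c : C) (f : R -> C) (a b : R) (l : C) :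
  is_CInt f a b l -> is_CInt (fun t => c * f t) a b (c * l).
Proof.
  intros H. apply is_CInt_Re_Im in H as [H1 H2]. apply is_CInt_Re_Im.
  split; unfold Cmult, Re, Im in *; simpl fst; simpl snd.
  - apply (is_RInt_minus (V := R_NormedModule));
      apply (is_RInt_scal (V := R_NormedModule)); assumption.
  - apply (is_RInt_plus (V := R_NormedModule));
      apply (is_RInt_scal (V := R_NormedModule)); assumption.
Qed.

Lemma is_CInt_Cderive (F f : R -> C) (a b : R) :
  (forall x, (Rmin a b <= x <= Rmax a b)%R -> is_Cderive F x (f x)) ->
  (forall x, (Rmin a b <= x <= Rmax a b)%R -> Ccontinuous f x) ->
  is_CInt f a b (F b - F a).
Proof.
  intros HF Hf. apply is_CInt_Re_Im. split.
  - apply (is_RInt_derive (V := R_CompleteNormedModule) (fun t => Re (F t)));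
      intros x Hx; [exact (proj1 (HF x Hx)) | exact (proj1 (Hf x Hx))].
  - apply (is_RInt_derive (V := R_CompleteNormedModule) (fun t => Im (F t)));
      intros x Hx; [exact (proj2 (HF x Hx)) | exact (proj2 (Hf x Hx))].
Qed.

Lemma Cmod_CInt_le (f : R -> C) (g : R -> R) (a b : R) (lf : C) (lg : R) :
  (a <= b)%R -> (forall x, (a <= x <= b)%R -> (Cmod (f x) <= g x)%R) ->
  is_CInt f a b lf -> is_RInt g a b lg -> (Cmod lf <= lg)%R.
Proof.
  intros Hab H Hf Hg. rewrite Cmod_norm.
  apply (norm_RInt_le (V := C_R_NormedModule) f g a b); trivial.
  intros x Hx. rewrite <- Cmod_norm. now apply H.
Qed.

(** * Improper integrals *)

Lemma ball_Cmod (x y : C) (eps : R) :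
  (Cmod (y - x) < eps)%R -> ball (M := C_R_NormedModule) x eps y.
Proof. apply C_NormedModule_mixin_compat1. Qed.

Lemma Cmod_ball (x y : C) (eps : posreal) :
  ball (M := C_R_NormedModule) x (eps / sqrt 2) y -> (Cmod (y - x) < eps)%R.
Proof.
  assert (H2 : (0 < sqrt 2)%R) by (apply sqrt_lt_R0; lra).
  assert (He : (0 < eps / sqrt 2)%R) by (apply Rdiv_lt_0_compat; [apply eps | trivial]).
  intros H. apply (C_NormedModule_mixin_compat2 x y (mkposreal _ He)) in H. simpl in H.
  replace (sqrt 2 * (eps / sqrt 2))%R with (pos eps) in H; [exact H|].
  field. lra.
Qed.

Lemma is_CInt_gen_eps (f : R -> C) (Fa Fb : (R -> Prop) -> Prop) (l : C)
  {FFa : Filter Fa} {FFb : Filter Fb} :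
  is_CInt_gen f Fa Fb l <->
  forall eps : posreal, filter_prod Fa Fb (fun ab =>
    exists I : C, is_CInt f (fst ab) (snd ab) I /\ (Cmod (I - l) < eps)%R).
Proof.
  split.
  - intros H eps.
    assert (H2 : (0 < sqrt 2)%R) by (apply sqrt_lt_R0; lra).
    assert (He : (0 < eps / sqrt 2)%R) by (apply Rdiv_lt_0_compat; [apply eps | trivial]).
    specialize (H _ (locally_ball (l : C_R_NormedModule) (mkposreal _ He))).
    unfold filtermapi in H.
    revert H. apply filter_imp. intros ab [I [HI HB]]. exists I. split; [exact HI|].
    now apply Cmod_ball.
  - intros H P [eps HP]. unfold filtermapi. generalize (H eps). apply filter_imp.
    intros ab [I [HI HB]]. exists I. split; [exact HI|]. now apply HP, ball_Cmod.
Qed.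

Lemma is_CInt_gen_Re (f : R -> C) (Fa Fb : (R -> Prop) -> Prop) (l : C)
  {FFa : Filter Fa} {FFb : Filter Fb} :
  is_CInt_gen f Fa Fb l -> is_RInt_gen (fun t => Re (f t)) Fa Fb (Re l).
Proof.
  intros H P [eps HP]. unfold filtermapi. generalize (proj1 (is_CInt_gen_eps f Fa Fb l) H eps).
  apply filter_imp. intros ab [I [HI HB]]. exists (Re I).
  split; [exact (proj1 (proj1 (is_CInt_Re_Im f _ _ I) HI))|]. apply HP.
  unfold ball; simpl; unfold AbsRing_ball, abs, minus, plus, opp; simpl.
  eapply Rle_lt_trans; [|exact HB]. apply (re_le_Cmod (I - l)).
Qed.

Lemma is_CInt_gen_mult_l (c : C) (f : R -> C) (Fa Fb : (R -> Prop) -> Prop) (l : C)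
  {FFa : Filter Fa} {FFb : Filter Fb} :
  is_CInt_gen f Fa Fb l -> is_CInt_gen (fun t => c * f t) Fa Fb (c * l).
Proof.
  intros H. apply (proj2 (is_CInt_gen_eps _ _ _ _)). intros eps.
  assert (Hc := Cmod_ge_0 c).
  assert (He : (0 < eps / (Cmod c + 1))%R).
  { apply Rdiv_lt_0_compat; [apply eps | lra]. }
  generalize (proj1 (is_CInt_gen_eps f Fa Fb l) H (mkposreal _ He)).
  apply filter_imp. intros ab [I [HI HB]]. exists (c * I).
  split; [now apply is_CInt_mult_l|]. simpl in HB.
  replace (c * I - c * l) with (c * (I - l)) by ring. rewrite Cmod_mult.
  apply Rlt_div_r in HB; [|lra]. assert (HI0 := Cmod_ge_0 (I - l)).
  destruct eps as [e He']; simpl in *.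
  destruct (Rle_lt_or_eq_dec _ _ HI0) as [P|E]; [nra|]. rewrite <- E. lra.
Qed.

(** Describing the ends of the interval [D] by filters treats finite and infinite
    ends alike. *)
Record interval_ends (D : R -> Prop) (Fa Fb : (R -> Prop) -> Prop) : Prop := {
  ends_lower : ProperFilter Fa;
  ends_upper : ProperFilter Fb;
  ends_prod : filter_prod Fa Fb (fun ab => D (fst ab) /\ D (snd ab) /\ (fst ab <= snd ab)%R);
  ends_convex : forall a b x, D a -> D b -> (a <= x <= b)%R -> D x
}.

Lemma interval_ends_between (D : R -> Prop) (Fa Fb : (R -> Prop) -> Prop) (a b x : R) :
  interval_ends D Fa Fb -> D a -> D b -> (Rmin a b <= x <= Rmax a b)%R -> D x.
Proof.
  intros E Ha Hb. unfold Rmin, Rmax.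
  destruct (Rle_dec a b); intros Hx;
    [apply (ends_convex _ _ _ E a b) | apply (ends_convex _ _ _ E b a)]; trivial.
Qed.

(** Cauchy's criterion: changing the bounds [s], [t] of the integral of [f]
    changes it by at most the change of the integral of [g]. *)
Lemma ex_CInt_gen_dominated (D : R -> Prop) (Fa Fb : (R -> Prop) -> Prop)
  (f : R -> C) (g : R -> R) (lg : R) :
  interval_ends D Fa Fb ->
  (forall x, D x -> Ccontinuous f x) -> (forall x, D x -> continuous g x) ->
  (forall x, D x -> (Cmod (f x) <= g x)%R) ->
  is_RInt_gen g Fa Fb lg -> exists lf : C, is_CInt_gen f Fa Fb lf.
Proof.
  intros E Hf Hg Hfg HG.
  assert (FFa := ends_lower _ _ _ E). assert (FFb := ends_upper _ _ _ E).
  assert (exf : forall a b, D a -> D b -> ex_CInt f a b).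
  { intros a b Ha Hb. apply ex_CInt_continuous. intros x Hx. apply Hf.
    now apply (interval_ends_between D Fa Fb a b x). }
  assert (exg : forall a b, D a -> D b -> ex_RInt g a b).
  { intros a b Ha Hb. apply (ex_RInt_continuous (V := R_CompleteNormedModule)).
    intros x Hx. apply Hg. now apply (interval_ends_between D Fa Fb a b x). }
  set (If := fun a b => RInt (V := C_R_CompleteNormedModule) f a b).
  set (Ig := fun a b => RInt (V := R_CompleteNormedModule) g a b).
  assert (cf : forall a b, D a -> D b -> is_CInt f a b (If a b)).
  { intros a b Ha Hb. apply (RInt_correct (V := C_R_CompleteNormedModule)). now apply exf. }
  assert (cg : forall a b, D a -> D b -> is_RInt g a b (Ig a b)).
  { intros a b Ha Hb. apply (RInt_correct (V := R_CompleteNormedModule)). now apply exg. }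
  assert (chf : forall a b c, D a -> D b -> D c -> If a b + If b c = If a c).
  { intros a b c Ha Hb Hc. apply (RInt_Chasles (V := C_R_CompleteNormedModule));
      now apply exf. }
  assert (chg : forall a b c, D a -> D b -> D c -> (Ig a b + Ig b c = Ig a c)%R).
  { intros a b c Ha Hb Hc. apply (RInt_Chasles (V := R_CompleteNormedModule));
      now apply exg. }
  assert (dom : forall a b, D a -> D b -> (Cmod (If a b) <= Rabs (Ig a b))%R).
  { assert (dom1 : forall a b, D a -> D b -> (a <= b)%R -> (Cmod (If a b) <= Rabs (Ig a b))%R).
    { intros a b Ha Hb Hab. eapply Rle_trans; [|apply Rle_abs].
      apply (Cmod_CInt_le f g a b); [trivial | | now apply cf | now apply cg].
      intros x Hx. apply Hfg. now apply (ends_convex _ _ _ E a b). }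
    intros a b Ha Hb. destruct (Rle_dec a b) as [H|H]; [now apply dom1|].
    assert (Z1 := chf a b a Ha Hb Ha). assert (Z2 := chg a b a Ha Hb Ha).
    assert (Y1 := chf a a a Ha Ha Ha). assert (Y2 := chg a a a Ha Ha Ha).
    replace (If a b) with (- If b a).
    2: { replace (If b a) with (If a b + If b a - If a b) by ring. rewrite Z1.
         replace (If a a) with (If a a + If a a - If a a) by ring. rewrite Y1. ring. }
    replace (Ig a b) with (- Ig b a)%R by lra.
    rewrite Cmod_opp, Rabs_Ropp. apply dom1; trivial. lra. }
  destruct (proj1 (filterlim_locally_cauchy (U := C_R_CompleteNormedModule)
    (F := filter_prod Fa Fb) (fun ab => If (fst ab) (snd ab)))) as [lf Hlf].
  - intros eps.
    assert (He : (0 < eps / 4)%R) by (destruct eps; simpl; lra).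
    assert (HG1 := HG _ (locally_ball (lg : R_NormedModule) (mkposreal _ He))).
    unfold filtermapi in HG1.
    destruct (filter_and _ _ HG1 (ends_prod _ _ _ E)) as [Q T HQ HT HP].
    exists (fun ab => Q (fst ab) /\ T (snd ab)). split.
    + now exists Q T.
    + assert (HP' : forall a b, Q a -> T b -> D a /\ D b /\ (Rabs (Ig a b - lg) < eps / 4)%R).
      { intros a b Ha Hb. destruct (HP a b Ha Hb) as [[I [HI HB]] [Da [Db _]]].
        simpl in *. split; [trivial|]. split; [trivial|].
        rewrite (is_RInt_unique (V := R_CompleteNormedModule) _ _ _ _ HI : Ig a b = I).
        exact HB. }
      intros [s t] [s' t'] [Hs Ht] [Hs' Ht']; simpl fst in *; simpl snd in *.
      destruct (HP' s t Hs Ht) as [Ds [Dt H1]].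
      destruct (HP' s' t Hs' Ht) as [Ds' [_ H2]].
      destruct (HP' s' t' Hs' Ht') as [_ [Dt' H3]].
      apply ball_Cmod.
      replace (If s' t' - If s t) with (If s' s + If t t').
      2: { rewrite <- (chf s' s t'), <- (chf s t t') by trivial. ring. }
      eapply Rle_lt_trans; [apply Cmod_triangle|].
      assert (N1 := dom s' s Ds' Ds). assert (N2 := dom t t' Dt Dt').
      assert (Z1 := chg s' s t Ds' Ds Dt). assert (Z2 := chg s' t t' Ds' Dt Dt').
      replace (Ig s' s) with ((Ig s' t - lg) - (Ig s t - lg))%R in N1 by lra.
      replace (Ig t t') with ((Ig s' t' - lg) - (Ig s' t - lg))%R in N2 by lra.
      assert (M1 := Rabs_triang (Ig s' t - lg) (- (Ig s t - lg))).
      assert (M2 := Rabs_triang (Ig s' t' - lg) (- (Ig s' t - lg))).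
      rewrite Rabs_Ropp in M1, M2. unfold Rminus at 1 in N1. unfold Rminus at 1 in N2. lra.
  - exists lf. intros P HP. apply Hlf in HP. unfold filtermap in HP. unfold filtermapi.
    generalize (filter_and _ _ HP (ends_prod _ _ _ E)). apply filter_imp.
    intros [a b] [H [Da [Db _]]]. exists (If a b). split; [now apply cf | exact H].
Qed.

Lemma Cmod_CInt_gen_le (D : R -> Prop) (Fa Fb : (R -> Prop) -> Prop)
  (f : R -> C) (g : R -> R) (lf : C) (lg : R) :
  interval_ends D Fa Fb ->
  (forall x, D x -> (Cmod (f x) <= g x)%R) ->
  is_CInt_gen f Fa Fb lf -> is_RInt_gen g Fa Fb lg -> (Cmod lf <= lg)%R.
Proof.
  intros E Hfg Hf Hg.
  assert (FFa := ends_lower _ _ _ E). assert (FFb := ends_upper _ _ _ E).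
  rewrite Cmod_norm.
  apply (RInt_gen_norm (V := C_R_CompleteNormedModule) (Fa := Fa) (Fb := Fb) f g); trivial;
    generalize (ends_prod _ _ _ E); apply filter_imp; intros [a b] [Da [Db Hab]]; simpl in *.
  - exact Hab.
  - intros x Hx. change (norm (f x)) with (norm (f x : C_R_NormedModule)).
    rewrite <- Cmod_norm. apply Hfg. now apply (ends_convex _ _ _ E a b).
Qed.

Lemma is_CInt_gen_Cderive (D : R -> Prop) (Fa Fb : (R -> Prop) -> Prop)
  (F f : R -> C) (la lb l : C) :
  interval_ends D Fa Fb -> l = lb - la ->
  (forall x, D x -> is_Cderive F x (f x)) -> (forall x, D x -> Ccontinuous f x) ->
  (forall eps, (0 < eps)%R -> Fa (fun x => (Cmod (F x - la) < eps)%R)) ->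
  (forall eps, (0 < eps)%R -> Fb (fun x => (Cmod (F x - lb) < eps)%R)) ->
  is_CInt_gen f Fa Fb l.
Proof.
  intros E -> HF Hf Ha Hb.
  assert (FFa := ends_lower _ _ _ E). assert (FFb := ends_upper _ _ _ E).
  apply (proj2 (is_CInt_gen_eps _ _ _ _)). intros eps.
  assert (He : (0 < eps / 2)%R) by (destruct eps; simpl; lra).
  assert (H : filter_prod Fa Fb (fun ab => (Cmod (F (fst ab) - la) < eps / 2)%R /\
    (Cmod (F (snd ab) - lb) < eps / 2)%R)).
  { exists (fun x => (Cmod (F x - la) < eps / 2)%R)
      (fun x => (Cmod (F x - lb) < eps / 2)%R); auto. }
  generalize (filter_and _ _ H (ends_prod _ _ _ E)). apply filter_imp.
  intros [a b] [[H1 H2] [Da [Db _]]]; simpl in *.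
  exists (F b - F a). split.
  - apply is_CInt_Cderive; intros x Hx; [apply HF | apply Hf];
      now apply (interval_ends_between D Fa Fb a b x).
  - replace (F b - F a - (lb - la)) with ((F b - lb) + - (F a - la)) by ring.
    eapply Rle_lt_trans; [apply Cmod_triangle|]. rewrite Cmod_opp. lra.
Qed.

Lemma is_CInt_gen_plus (f g : R -> C) (Fa Fb : (R -> Prop) -> Prop) (l m : C)
  {FFa : Filter Fa} {FFb : Filter Fb} :
  is_CInt_gen f Fa Fb l -> is_CInt_gen g Fa Fb m ->
  is_CInt_gen (fun t => f t + g t) Fa Fb (l + m).
Proof. apply (is_RInt_gen_plus (V := C_R_NormedModule)). Qed.

Lemma is_CInt_gen_ext (D : R -> Prop) (Fa Fb : (R -> Prop) -> Prop)
  (f g : R -> C) (l : C) :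
  interval_ends D Fa Fb -> (forall x, D x -> f x = g x) ->
  is_CInt_gen f Fa Fb l -> is_CInt_gen g Fa Fb l.
Proof.
  intros E H.
  assert (FFa := ends_lower _ _ _ E). assert (FFb := ends_upper _ _ _ E).
  apply (is_RInt_gen_ext (V := C_R_NormedModule)).
  generalize (ends_prod _ _ _ E). apply filter_imp.
  intros [a b] [Da [Db _]] x Hx. apply H.
  apply (interval_ends_between D Fa Fb a b x); trivial; simpl in *; lra.
Qed.

Lemma is_CInt_gen_inj (D : R -> Prop) (Fa Fb : (R -> Prop) -> Prop)
  (f : R -> C) (l m : C) :
  interval_ends D Fa Fb -> is_CInt_gen f Fa Fb l -> is_CInt_gen f Fa Fb m -> l = m.
Proof.
  intros E Hl Hm.
  assert (FFa := ends_lower _ _ _ E). assert (FFb := ends_upper _ _ _ E).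
  rewrite <- (is_RInt_gen_unique (V := C_R_CompleteNormedModule) _ _ Hl).
  now rewrite <- (is_RInt_gen_unique (V := C_R_CompleteNormedModule) _ _ Hm).
Qed.

(** * The Beta integral *)

Lemma unit_interval_ends :
  interval_ends (fun t => 0 < t < 1)%R (at_right 0) (at_left 1).
Proof.
  split; try typeclasses eauto.
  - exists (fun t => 0 < t < / 2)%R (fun t => / 2 < t < 1)%R.
    + exists (mkposreal (/ 2) ltac:(lra)). intros t B H.
      change (Rabs (t - 0) < / 2)%R in B. apply Rabs_def2 in B. lra.
    + exists (mkposreal (/ 2) ltac:(lra)). intros t B H.
      change (Rabs (t - 1) < / 2)%R in B. apply Rabs_def2 in B. lra.
    + simpl. intros; lra.
  - intros; lra.
Qed.

Lemma exp_mul_ln_small (p eps : R) :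
  (0 < p)%R -> (0 < eps)%R ->
  exists d : posreal, forall t, (0 < t < d)%R -> (exp (p * ln t) < eps)%R.
Proof.
  intros Hp He. exists (mkposreal (exp (ln eps / p)) (exp_pos _)). simpl.
  intros t [Ht1 Ht2].
  rewrite <- (exp_ln eps) by trivial. apply exp_increasing.
  apply ln_increasing in Ht2; trivial. rewrite ln_exp in Ht2.
  apply (Rmult_lt_compat_l p) in Ht2; trivial.
  replace (p * (ln eps / p))%R with (ln eps) in Ht2 by (field; lra). exact Ht2.
Qed.

Lemma rcpow_at_right_0 (s : C) (eps : R) :
  (0 < Re s)%R -> (0 < eps)%R -> at_right 0 (fun t => (Cmod (rcpow t s) < eps)%R).
Proof.
  intros Hs He. destruct (exp_mul_ln_small (Re s) eps Hs He) as [d Hd].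
  exists d. intros t B H. change (Rabs (t - 0) < d)%R in B.
  rewrite Cmod_rcpow. apply Hd. apply Rabs_def2 in B. lra.
Qed.

Lemma rcpow_at_left_1 (s : C) (eps : R) :
  (0 < Re s)%R -> (0 < eps)%R -> at_left 1 (fun t => (Cmod (rcpow (1 - t) s) < eps)%R).
Proof.
  intros Hs He. destruct (exp_mul_ln_small (Re s) eps Hs He) as [d Hd].
  exists d. intros t B H. change (Rabs (t - 1) < d)%R in B.
  rewrite Cmod_rcpow. apply Hd. apply Rabs_def2 in B. lra.
Qed.

Lemma Cmod_rcpow_le_1 (t : R) (s : C) :
  (0 < t <= 1)%R -> (0 <= Re s)%R -> (Cmod (rcpow t s) <= 1)%R.
Proof.
  intros Ht Hs. rewrite Cmod_rcpow, <- exp_0. apply exp_le.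
  assert (L := ln_le_sub_1 t ltac:(lra)). nra.
Qed.

Lemma is_Cderive_rcpow_compl (s : C) (t : R) :
  (t < 1)%R -> is_Cderive (fun u => rcpow (1 - u) s) t (- (s * rcpow (1 - t) (s - 1))).
Proof.
  intros Ht. eapply is_Cderive_ext_val.
  2: { apply (is_Cderive_comp (fun u => rcpow u s) (fun u => 1 - u)%R t (-1)%R).
       - apply is_Cderive_rcpow; lra.
       - auto_derive; [trivial | ring]. }
  rewrite (RtoC_opp 1 : RtoC (-1)%R = - (1)). ring.
Qed.

Lemma Ccontinuous_rcpow (s : C) (t : R) :
  (0 < t)%R -> Ccontinuous (fun u => rcpow u s) t.
Proof. intros H. eapply is_Cderive_continuous. now apply is_Cderive_rcpow. Qed.

Lemma Ccontinuous_rcpow_compl (s : C) (t : R) :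
  (t < 1)%R -> Ccontinuous (fun u => rcpow (1 - u) s) t.
Proof. intros H. eapply is_Cderive_continuous. now apply is_Cderive_rcpow_compl. Qed.

Lemma Ccontinuous_const (c : C) (t : R) : Ccontinuous (fun _ => c) t.
Proof. eapply is_Cderive_continuous. apply is_Cderive_const. Qed.

Lemma is_CInt_gen_rcpow (s : C) :
  (0 < Re s)%R -> is_CInt_gen (fun t => s * rcpow t (s - 1)) (at_right 0) (at_left 1) (RtoC 1).
Proof.
  intros Hs.
  apply (is_CInt_gen_Cderive _ _ _ (fun t => rcpow t s) _ 0 1 _ unit_interval_ends).
  - ring.
  - intros x Hx. now apply is_Cderive_rcpow.
  - intros x Hx. apply Ccontinuous_mult; [apply Ccontinuous_const | now apply Ccontinuous_rcpow].
  - intros eps He. generalize (rcpow_at_right_0 s eps Hs He). apply filter_imp.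
    intros x Hx. now replace (rcpow x s - 0) with (rcpow x s) by ring.
  - intros eps He. rewrite <- (rcpow_1_l s). apply filter_le_within.
    apply Ccontinuous_locally; [trivial | apply Ccontinuous_rcpow; lra].
Qed.

Lemma is_CInt_gen_rcpow_compl (s : C) :
  (0 < Re s)%R ->
  is_CInt_gen (fun t => s * rcpow (1 - t) (s - 1)) (at_right 0) (at_left 1) (RtoC 1).
Proof.
  intros Hs.
  apply (is_CInt_gen_Cderive _ _ _ (fun t => - (1) * rcpow (1 - t) s) _ (- (1)) 0 _
    unit_interval_ends).
  - ring.
  - intros x Hx. eapply is_Cderive_ext_val.
    2: { apply is_Cderive_mult; [apply is_Cderive_const|].
         apply is_Cderive_rcpow_compl; lra. }
    cbv beta. ring.
  - intros x Hx. apply Ccontinuous_mult; [apply Ccontinuous_const|].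
    apply Ccontinuous_rcpow_compl; lra.
  - intros eps He. apply filter_le_within.
    assert (H := Ccontinuous_locally (fun t => - (1) * rcpow (1 - t) s) 0 eps He).
    cbv beta in H. rewrite Rminus_0_r, rcpow_1_l, Cmult_1_r in H. apply H.
    apply Ccontinuous_mult; [apply Ccontinuous_const|].
    apply Ccontinuous_rcpow_compl; lra.
  - intros eps He. generalize (rcpow_at_left_1 s eps Hs He). apply filter_imp.
    intros x Hx. replace (- (1) * rcpow (1 - x) s - 0) with (- rcpow (1 - x) s) by ring.
    now rewrite Cmod_opp.
Qed.

Definition beta_integrand (alpha beta : C) (t : R) : C :=
  rcpow t (alpha - 1) * rcpow (1 - t) (beta - 1).

Notation is_Beta alpha beta :=
  (is_CInt_gen (beta_integrand alpha beta) (at_right 0) (at_left 1)).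

Lemma Ccontinuous_beta_integrand (alpha beta : C) (t : R) :
  (0 < t < 1)%R -> Ccontinuous (beta_integrand alpha beta) t.
Proof.
  intros Ht. apply Ccontinuous_mult;
    [apply Ccontinuous_rcpow | apply Ccontinuous_rcpow_compl]; lra.
Qed.

Lemma Cmod_beta_integrand (alpha beta : C) (t : R) :
  Cmod (beta_integrand alpha beta t) =
  (exp ((Re alpha - 1) * ln t) * exp ((Re beta - 1) * ln (1 - t)))%R.
Proof. unfold beta_integrand. now rewrite Cmod_mult, !Cmod_rcpow. Qed.

(** On each half of the unit interval one of the two factors is bounded. *)
Lemma ex_Beta (alpha beta : C) :
  (0 < Re alpha)%R -> (0 < Re beta)%R -> exists l : C, is_Beta alpha beta l.
Proof.
  intros Ha Hb.
  set (p := Re alpha) in *. set (q := Re beta) in *.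
  set (M1 := exp (Rabs (q - 1) * ln 2)). set (M2 := exp (Rabs (p - 1) * ln 2)).
  set (h := fun t => (RtoC M1 / p) * (p * rcpow t (p - 1))
    + (RtoC M2 / q) * (q * rcpow (1 - t) (q - 1))).
  assert (Hh : is_CInt_gen h (at_right 0) (at_left 1) (RtoC M1 / p * 1 + RtoC M2 / q * 1)).
  { apply (is_CInt_gen_plus _ _ _ _ _ _); apply (is_CInt_gen_mult_l _ _ _ _ _);
      [now apply is_CInt_gen_rcpow | now apply is_CInt_gen_rcpow_compl]. }
  assert (Eh : forall t, h t = RtoC (M1 * exp ((p - 1) * ln t) + M2 * exp ((q - 1) * ln (1 - t)))).
  { intros t. unfold h. rewrite <- !RtoC_minus, !rcpow_RtoC, RtoC_plus, !RtoC_mult.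
    field. split; apply RtoC_neq_0; lra. }
  apply is_CInt_gen_Re in Hh; try typeclasses eauto.
  refine (ex_CInt_gen_dominated _ _ _ _ (fun t => Re (h t)) _ unit_interval_ends
    _ _ _ Hh).
  - apply Ccontinuous_beta_integrand.
  - intros t Ht.
    apply (continuous_ext
      (fun t => M1 * exp ((p - 1) * ln t) + M2 * exp ((q - 1) * ln (1 - t)))%R).
    { intros u. now rewrite Eh. }
    apply (ex_derive_continuous (V := R_NormedModule)). auto_derive. lra.
  - intros t Ht. rewrite Cmod_beta_integrand, Eh. fold p q. simpl.
    set (A := exp ((p - 1) * ln t)). set (B := exp ((q - 1) * ln (1 - t))).
    assert (HA : (0 < A)%R) by apply exp_pos. assert (HB : (0 < B)%R) by apply exp_pos.
    assert (H1 : (0 < M1)%R) by apply exp_pos. assert (H2 : (0 < M2)%R) by apply exp_pos.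
    destruct (Rle_dec t (/ 2)) as [H|H].
    + assert (B <= M1)%R by (apply exp_mul_ln_le; lra). nra.
    + assert (A <= M2)%R by (apply exp_mul_ln_le; lra). nra.
Qed.

Lemma rcpow_sub_1 (t : R) (s : C) :
  (0 < t)%R -> rcpow t s = RtoC t * rcpow t (s - 1).
Proof.
  intros Ht. rewrite <- (rcpow_1_r t) at 1 by trivial. rewrite <- rcpow_plus.
  f_equal. ring.
Qed.

(** Integrating the derivative of [t ^ alpha (1 - t) ^ beta], which vanishes at
    both ends. *)
Lemma Beta_recurrence (alpha beta l m : C) :
  (0 < Re alpha)%R -> (0 < Re beta)%R ->
  is_Beta alpha beta l -> is_Beta alpha (beta + 1) m ->
  beta * l = (alpha + beta) * m.
Proof.
  intros Ha Hb Hl Hm.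
  set (F := fun t => rcpow t alpha * rcpow (1 - t) beta).
  set (f := fun t => (alpha + beta) * beta_integrand alpha (beta + 1) t
    + - beta * beta_integrand alpha beta t).
  assert (H1 : is_CInt_gen f (at_right 0) (at_left 1) ((alpha + beta) * m + - beta * l)).
  { apply (is_CInt_gen_plus _ _ _ _ _ _); now apply (is_CInt_gen_mult_l _ _ _ _ _). }
  assert (H2 : is_CInt_gen f (at_right 0) (at_left 1) (RtoC 0)).
  { apply (is_CInt_gen_Cderive _ _ _ F _ 0 0 _ unit_interval_ends).
    - ring.
    - intros t Ht. unfold F, f, beta_integrand. eapply is_Cderive_ext_val.
      2: { apply is_Cderive_mult; [apply is_Cderive_rcpow | apply is_Cderive_rcpow_compl]; lra. }
      cbv beta. replace (beta + 1 - 1) with beta by ring.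
      rewrite (rcpow_sub_1 t alpha), (rcpow_sub_1 (1 - t) beta), RtoC_minus by lra. ring.
    - intros t Ht. unfold f.
      assert (P : forall a b, Ccontinuous (fun u => a * beta_integrand alpha b u) t).
      { intros a b. apply Ccontinuous_mult; [apply Ccontinuous_const|].
        now apply Ccontinuous_beta_integrand. }
      apply Ccontinuous_plus; apply P.
    - intros eps He.
      assert (U : at_right 0 (fun t => (0 < t < 1)%R)).
      { exists (mkposreal 1 Rlt_0_1). intros t B H.
        change (Rabs (t - 0) < 1)%R in B. apply Rabs_def2 in B. lra. }
      generalize (filter_and _ _ U (rcpow_at_right_0 alpha eps Ha He)). apply filter_imp.
      intros t [Ht H]. unfold F. replace (_ - 0) with (rcpow t alpha * rcpow (1 - t) beta) by ring.
      rewrite Cmod_mult.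
      assert (L := Cmod_rcpow_le_1 (1 - t) beta ltac:(lra) ltac:(lra)).
      assert (P := Cmod_ge_0 (rcpow t alpha)). nra.
    - intros eps He.
      assert (U : at_left 1 (fun t => (0 < t < 1)%R)).
      { exists (mkposreal 1 Rlt_0_1). intros t B H.
        change (Rabs (t - 1) < 1)%R in B. apply Rabs_def2 in B. lra. }
      generalize (filter_and _ _ U (rcpow_at_left_1 beta eps Hb He)). apply filter_imp.
      intros t [Ht H]. unfold F. replace (_ - 0) with (rcpow t alpha * rcpow (1 - t) beta) by ring.
      rewrite Cmod_mult.
      assert (L := Cmod_rcpow_le_1 t alpha ltac:(lra) ltac:(lra)).
      assert (P := Cmod_ge_0 (rcpow (1 - t) beta)). nra. }
  assert (E := is_CInt_gen_inj _ _ _ _ _ _ unit_interval_ends H1 H2).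
  replace (beta * l) with (beta * l + ((alpha + beta) * m + - beta * l - 0))
    by (rewrite E; ring).
  ring.
Qed.

(** The recurrence starts from [B (alpha, 1) = 1 / alpha]. *)
Lemma Beta_nat (alpha : C) (n : nat) :
  (0 < Re alpha)%R ->
  is_Beta alpha (INR n + 1) (INR (fact n) / rising alpha (S n)).
Proof.
  intros Ha.
  assert (Hr : forall n, rising alpha n <> 0).
  { intros k. apply rising_neq_0. intros j. now apply Re_pos_not_pole. }
  induction n as [|n IH].
  - assert (Ha0 : alpha <> 0).
    { intros E. rewrite E in Ha. simpl in Ha. lra. }
    replace (INR (fact 0) / rising alpha 1) with (/ alpha * 1).
    2: { replace (rising alpha 1) with alpha by (unfold rising; simpl; ring).
         simpl. field. trivial. }
    refine (is_CInt_gen_ext _ _ _ _ _ _ unit_interval_ends _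
      (is_CInt_gen_mult_l (/ alpha) _ _ _ _ (is_CInt_gen_rcpow alpha Ha))).
    intros t Ht. unfold beta_integrand. simpl (INR 0).
    replace (0 + 1 - 1) with (RtoC 0) by ring. rewrite rcpow_0_r. field. trivial.
  - assert (HB : (0 < Re (RtoC (INR n) + 1))%R).
    { simpl. assert (H := pos_INR n). lra. }
    rewrite S_INR, RtoC_plus.
    destruct (ex_Beta alpha (RtoC (INR n) + 1 + 1) Ha) as [m Hm].
    { simpl. simpl in HB. lra. }
    assert (E := Beta_recurrence _ _ _ _ Ha HB IH Hm).
    replace (_ / _) with m; [exact Hm|].
    assert (HS := Hr (S (S n))). rewrite rising_S in HS.
    rewrite (rising_S alpha (S n)), S_INR, RtoC_plus in *.
    replace (fact (S n)) with (S n * fact n)%nat by reflexivity.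
    rewrite mult_INR, S_INR, RtoC_mult, RtoC_plus.
    assert (N1 : alpha + (INR n + 1) <> 0).
    { intros E1. apply HS. rewrite E1. ring. }
    replace m with ((alpha + (INR n + 1)) * m / (alpha + (INR n + 1))) by (field; trivial).
    rewrite <- E. field. split; trivial; apply Hr.
Qed.

Lemma Beta_iterate (alpha beta l : C) (n : nat) :
  (0 < Re alpha)%R -> (0 < Re beta)%R -> is_Beta alpha beta l ->
  is_Beta alpha (beta + INR n) (rising beta n / rising (alpha + beta) n * l).
Proof.
  intros Ha Hb Hl.
  assert (Hr : forall n, rising (alpha + beta) n <> 0).
  { intros k. apply rising_neq_0. intros j. apply Re_pos_not_pole. simpl.
    unfold Re in *. lra. }
  induction n as [|n IH].
  - replace (beta + INR 0) with beta by (simpl; ring).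
    replace (_ / _ * l) with l; trivial.
    change (rising beta 0) with (RtoC 1).
    change (rising (alpha + beta) 0) with (RtoC 1). field.
  - assert (HB : (0 < Re (beta + INR n))%R).
    { simpl. assert (H := pos_INR n). unfold Re in *. lra. }
    destruct (ex_Beta alpha (beta + INR n + 1) Ha) as [m Hm].
    { simpl. simpl in HB. unfold Re in *. lra. }
    assert (E := Beta_recurrence _ _ _ _ Ha HB IH Hm).
    replace (beta + INR (S n)) with (beta + INR n + 1) by (rewrite S_INR, RtoC_plus; ring).
    assert (HS := Hr (S n)). rewrite rising_S in HS.
    rewrite !rising_S.
    assert (N1 : alpha + beta + INR n <> 0).
    { intros E1. apply HS. rewrite E1. ring. }
    replace (_ / _ * l) with m; [exact Hm|].
    replace m with ((alpha + (beta + INR n)) * m / (alpha + beta + INR n)) by (field; trivial).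
    rewrite <- E. field. split; trivial; apply Hr.
Qed.

(** By the mean value theorem on the left half of the unit interval; on the right
    half the left-hand side is at most [2 <= 4 t]. *)
Lemma rcpow_compl_minus_1 (s : C) :
  (0 < Re s)%R -> exists K : R, (0 <= K)%R /\
    forall t, (0 < t < 1)%R -> (Cmod (rcpow (1 - t) s - 1) <= K * t)%R.
Proof.
  intros Hs.
  set (D := (Cmod s * exp (Rabs (Re (s - 1)) * ln 2))%R).
  assert (HD : (0 <= D)%R).
  { apply Rmult_le_pos; [apply Cmod_ge_0 | apply Rlt_le, exp_pos]. }
  exists (2 * D + 4)%R. split; [lra|]. intros t Ht.
  destruct (Rle_dec t (/ 2)) as [H|H].
  - apply Rle_trans with (2 * D * t)%R; [|nra].
    replace (RtoC 1) with (rcpow (1 - 0) s) by now rewrite Rminus_0_r, rcpow_1_l.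
    apply (Cmod_mean_value (fun t => rcpow (1 - t) s)
      (fun t => - (s * rcpow (1 - t) (s - 1)))); [lra|].
    intros u Hu. assert (A := Rle_abs u). assert (B := Rle_abs (- u)).
    rewrite Rabs_Ropp in B. split.
    + apply is_Cderive_rcpow_compl. lra.
    + rewrite Cmod_opp, Cmod_mult, Cmod_rcpow.
      apply Rmult_le_compat_l; [apply Cmod_ge_0|]. apply exp_mul_ln_le. lra.
  - assert (T := Cmod_triangle (rcpow (1 - t) s) (- (1))).
    rewrite Cmod_m1 in T.
    assert (L := Cmod_rcpow_le_1 (1 - t) s ltac:(lra) ltac:(lra)).
    unfold Cminus. nra.
Qed.

(** With [B] for the Beta integral, [n ^ alpha B(alpha, n + 1)] is the
    reciprocal of the [n]-th term of the Gauss product for [alpha]; replacing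
    [n + 1] by [beta + n + 1] changes it by [O(1 / n)], because
    [(1 - t) ^ beta - 1 = O(t)] raises the first parameter by one. The
    recurrence turns [B(alpha, beta + n + 1)] into [B(alpha, beta)]. *)
Theorem is_Beta_Gamma (alpha beta : C) :
  (0 < Re alpha)%R -> (0 < Re beta)%R ->
  is_Beta alpha beta (Gamma alpha * Gamma beta * rGamma (alpha + beta)).
Proof.
  intros Ha Hb.
  assert (Hab : (0 < Re (alpha + beta))%R) by (simpl; unfold Re in *; lra).
  destruct (ex_Beta alpha beta Ha Hb) as [l Hl].
  set (a := Re alpha).
  set (L := fun n => rising beta (S n) / rising (alpha + beta) (S n) * l).
  set (V := fun n => INR (fact n) / rising alpha (S n)).
  set (W := fun n => INR (fact n) / rising (RtoC a + 1) (S n)).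
  destruct (rcpow_compl_minus_1 beta Hb) as [K [HK0 HK]].
  assert (HW : forall n, is_Beta (RtoC a + 1) (INR n + 1) (W n)).
  { intros n. apply Beta_nat. simpl. unfold a. lra. }
  assert (Hd : forall n, (Cmod (L n - V n) <= K * Cmod (W n))%R).
  { intros n.
    apply Rle_trans with (K * Re (W n))%R.
    2: { apply Rmult_le_compat_l; trivial.
         eapply Rle_trans; [apply Rle_abs | apply re_le_Cmod]. }
    assert (H : is_CInt_gen (fun t => beta_integrand alpha (beta + INR (S n)) t
      + - (1) * beta_integrand alpha (INR n + 1) t) (at_right 0) (at_left 1)
      (L n + - (1) * V n)).
    { apply (is_CInt_gen_plus _ _ _ _ _ _).
      - now apply Beta_iterate.
      - apply (is_CInt_gen_mult_l _ _ _ _ _). now apply Beta_nat. }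
    replace (L n - V n) with (L n + - (1) * V n) by ring.
    refine (Cmod_CInt_gen_le _ _ _ _ _ _ _ unit_interval_ends _ H
      (is_RInt_gen_scal (V := R_NormedModule) _ K _
        (is_CInt_gen_Re _ _ _ _ (HW n)))).
    intros t Ht. unfold beta_integrand.
    replace (INR n + 1 - 1) with (RtoC (INR n)) by ring.
    replace (beta + INR (S n) - 1) with (beta + RtoC (INR n))
      by (rewrite S_INR, RtoC_plus; ring).
    replace (RtoC a + 1 - 1) with (RtoC a) by ring.
    rewrite rcpow_plus.
    match goal with |- (Cmod ?z <= _)%R => replace z with
      (rcpow t (alpha - 1) * rcpow (1 - t) (INR n) * (rcpow (1 - t) beta - 1)) by ring end.
    rewrite !Cmod_mult, !Cmod_rcpow, !rcpow_RtoC, <- RtoC_mult.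
    unfold scal; simpl; unfold mult; simpl.
    change (fst alpha + - (1))%R with (a - 1)%R.
    replace (exp (a * ln t)) with (exp ((a - 1) * ln t) * t)%R.
    2: { rewrite <- (exp_ln t) at 2 by lra. rewrite <- exp_plus. f_equal. ring. }
    assert (P1 := exp_pos ((a - 1) * ln t)).
    assert (P2 := exp_pos (INR n * ln (1 - t))).
    replace (K * (exp ((a - 1) * ln t) * t * exp (INR n * ln (1 - t))))%R
      with (exp ((a - 1) * ln t) * exp (INR n * ln (1 - t)) * (K * t))%R by ring.
    apply Rmult_le_compat_l; [nra | now apply HK]. }
  assert (Nbeta : forall n, rGamma_seq (alpha + beta) n <> 0).
  { intros n. apply rGamma_seq_neq_0. intros k. now apply Re_pos_not_pole. }
  assert (Nalpha : forall n, rGamma_seq alpha n <> 0).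
  { intros n. apply rGamma_seq_neq_0. intros k. now apply Re_pos_not_pole. }
  assert (Rab : rGamma (alpha + beta) <> 0) by now apply rGamma_neq_0_Re.
  assert (Ra : rGamma alpha <> 0) by now apply rGamma_neq_0_Re.
  assert (Rb : rGamma beta <> 0) by now apply rGamma_neq_0_Re.
  assert (Rising : forall z n, rGamma_seq z n <> 0 -> rising z (S n) <> 0).
  { intros z n H E. apply H. rewrite rGamma_seq_rising, E. unfold Cdiv. ring. }
  assert (CL : Ccv (fun n => rcpow (INR n) alpha * L n)
    (rGamma beta * / rGamma (alpha + beta) * l)).
  { apply Ccv_ext with
      (fun n => rGamma_seq beta n * / rGamma_seq (alpha + beta) n * l).
    - intros n. unfold L. assert (Q := Rising _ _ (Nbeta n)).
      rewrite !rGamma_seq_rising, rcpow_plus. field.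
      repeat split; trivial; first [apply rcpow_neq_0 | apply INR_fact_neq_0_C].
    - apply Ccv_mult; [|apply Ccv_const]. apply Ccv_mult; [apply rGamma_correct|].
      apply Ccv_inv; trivial. apply rGamma_correct. }
  assert (CV : Ccv (fun n => rcpow (INR n) alpha * V n) (/ rGamma alpha)).
  { apply Ccv_ext with (fun n => / rGamma_seq alpha n).
    - intros n. unfold V. assert (Q := Rising _ _ (Nalpha n)).
      rewrite !rGamma_seq_rising. field.
      repeat split; trivial; first [apply rcpow_neq_0 | apply INR_fact_neq_0_C].
    - apply Ccv_inv; trivial. apply rGamma_correct. }
  assert (CL' : Ccv (fun n => rcpow (INR n) alpha * L n) (/ rGamma alpha)).
  { apply Ccv_ext with (fun n => rcpow (INR n) alpha * V n
      + rcpow (INR n) alpha * (L n - V n)); [intros n; ring|].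
    replace (/ rGamma alpha) with (/ rGamma alpha + 0) by ring.
    apply Ccv_plus; trivial.
    assert (Ha1 : (0 < Re (RtoC a + 1))%R) by (simpl; unfold a; lra).
    assert (N1 : forall n, rGamma_seq (RtoC a + 1) n <> 0).
    { intros n. apply rGamma_seq_neq_0. intros k. now apply Re_pos_not_pole. }
    assert (CW : Ccv (fun n => / rGamma_seq (RtoC a + 1) n) (/ rGamma (RtoC a + 1))).
    { apply Ccv_inv; trivial; [now apply rGamma_neq_0_Re | apply rGamma_correct]. }
    apply Ccv_Cmod in CW.
    (* [n ^ a W n] is [1 / n] times the reciprocal of a Gauss product term, and
       the latter converges. *)
    apply (Ccv_incr_n _ 1).
    apply Ccv_le with (fun n => K * Cmod (/ rGamma_seq (RtoC a + 1) (n + 1))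
      * / INR (n + 1))%R.
    - intros n.
      replace (rcpow (INR (n + 1)) alpha * (L (n + 1)%nat - V (n + 1)%nat) - 0)
        with (rcpow (INR (n + 1)) alpha * (L (n + 1)%nat - V (n + 1)%nat)) by ring.
      set (N := (n + 1)%nat).
      assert (HN : (0 < INR N)%R) by (apply lt_0_INR; unfold N; lia).
      rewrite Cmod_mult, Cmod_rcpow. fold a.
      eapply Rle_trans.
      { apply Rmult_le_compat_l; [apply Rlt_le, exp_pos | apply Hd]. }
      apply Req_le.
      assert (E : / rGamma_seq (RtoC a + 1) N
        = RtoC (INR N * exp (a * ln (INR N))) * W N).
      { unfold W. assert (Q := Rising _ _ (N1 N)).
        rewrite rGamma_seq_rising, rcpow_plus, rcpow_1_r, rcpow_RtoC, RtoC_mult by trivial.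
        field. repeat split; trivial; try apply INR_fact_neq_0_C;
          apply RtoC_neq_0; apply Rgt_not_eq; trivial; apply exp_pos. }
      rewrite E, Cmod_mult, Cmod_RtoC_pos.
      + field. lra.
      + apply Rlt_le, Rmult_lt_0_compat; [trivial | apply exp_pos].
    - replace (Finite 0) with (Finite (K * Cmod (/ rGamma (RtoC a + 1)) * 0))
        by (f_equal; ring).
      apply is_lim_seq_mult'.
      + apply is_lim_seq_mult'; [apply is_lim_seq_const|].
        apply (is_lim_seq_incr_n (fun n => Cmod (/ rGamma_seq (RtoC a + 1) n)) 1), CW.
      + apply (is_lim_seq_incr_n (fun n => / INR n)%R 1), is_lim_seq_inv_INR. }
  assert (E := Ccv_unique _ _ _ CL CL').
  replace (Gamma alpha * Gamma beta * rGamma (alpha + beta)) with l; trivial.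
  unfold Gamma. rewrite <- E. field. now split.
Qed.

(** * Change of variables *)

Lemma Ccontinuous_continuous (f : R -> C) (x : R) :
  Ccontinuous f x -> continuous (U := C_R_NormedModule) f x.
Proof.
  intros H. apply (filterlim_locally (U := C_R_NormedModule)). intros eps.
  generalize (Ccontinuous_locally f x eps (cond_pos eps) H). apply filter_imp.
  intros t Ht. now apply ball_Cmod.
Qed.

Lemma is_CInt_gen_comp (D D' : R -> Prop) (Fa Fb Ga Gb : (R -> Prop) -> Prop)
  (f : R -> C) (g g' : R -> R) (l : C) :
  interval_ends D Fa Fb -> interval_ends D' Ga Gb ->
  (forall x, D x -> D' (g x)) -> (forall x, D' x -> Ccontinuous f x) ->
  (forall x, D x -> is_derive g x (g' x)) -> (forall x, D x -> continuous g' x) ->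
  filterlim g Fa Ga -> filterlim g Fb Gb ->
  is_CInt_gen f Ga Gb l ->
  is_CInt_gen (fun x => RtoC (g' x) * f (g x)) Fa Fb l.
Proof.
  intros E E' HD Hf Hg Hg' La Lb H.
  assert (FFa := ends_lower _ _ _ E). assert (FFb := ends_upper _ _ _ E).
  assert (GGa := ends_lower _ _ _ E'). assert (GGb := ends_upper _ _ _ E').
  apply (proj2 (is_CInt_gen_eps _ _ _ _)). intros eps.
  destruct (proj1 (is_CInt_gen_eps _ _ _ _) H eps) as [Q T HQ HT HP].
  assert (H' : filter_prod Fa Fb (fun ab => Q (g (fst ab)) /\ T (g (snd ab)))).
  { exists (fun x => Q (g x)) (fun x => T (g x)); auto;
      [exact (La Q HQ) | exact (Lb T HT)]. }
  generalize (filter_and _ _ H' (ends_prod _ _ _ E)). apply filter_imp.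
  intros [a b] [[Qa Tb] [Da [Db _]]]; simpl in *.
  destruct (HP (g a) (g b) Qa Tb) as [I [HI HB]]. simpl in *.
  exists I. split; trivial.
  assert (In : forall x, (Rmin a b <= x <= Rmax a b)%R -> D x).
  { intros x Hx. now apply (interval_ends_between D Fa Fb a b x). }
  apply (is_RInt_ext (V := C_R_NormedModule)
    (fun x => scal (V := C_R_NormedModule) (g' x) (f (g x)))).
  { intros x _. unfold scal; simpl. unfold prod_scal, scal; simpl. unfold mult; simpl.
    unfold Cmult, RtoC; simpl. f_equal; ring. }
  rewrite <- (is_RInt_unique (V := C_R_CompleteNormedModule) _ _ _ _ HI).
  apply (is_RInt_comp (V := C_R_CompleteNormedModule)).
  - intros x Hx. apply Ccontinuous_continuous, Hf, HD, In, Hx.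
  - intros x Hx. split; [apply Hg, In, Hx | apply Hg', In, Hx].
Qed.

(** * Oberhettinger's integral *)

Lemma half_line_ends :
  interval_ends (fun x => 0 < x)%R (at_right 0) (Rbar_locally p_infty).
Proof.
  split; try typeclasses eauto.
  - exists (fun t => 0 < t < 1)%R (fun t => 1 < t)%R.
    + exists (mkposreal 1 Rlt_0_1). intros t B H.
      change (Rabs (t - 0) < 1)%R in B. apply Rabs_def2 in B. lra.
    + exists 1%R. trivial.
    + simpl. intros; lra.
  - intros; lra.
Qed.

(** With [x = a (cosh t - 1)] this is [a e ^ t]. *)
Definition ober (a x : R) : R := (x + a + sqrt (x ^ 2 + 2 * a * x))%R.

(** In the same parametrization this is [1 - e ^ (- t)], which increases from [0]
    to [1]. *)
Definition ober_var (a x : R) : R := (1 - a / ober a x)%R.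

Lemma ober_gt (a x : R) : (0 < a)%R -> (0 < x)%R -> (2 * x < ober a x /\ a < ober a x)%R.
Proof.
  intros Ha Hx. unfold ober.
  assert (H : (x < sqrt (x ^ 2 + 2 * a * x))%R).
  { rewrite <- (sqrt_pow2 x) at 1 by lra. apply sqrt_lt_1; nra. }
  lra.
Qed.

Lemma ober_var_bounds (a x : R) :
  (0 < a)%R -> (0 < x)%R -> (0 < ober_var a x < 1)%R.
Proof.
  intros Ha Hx. destruct (ober_gt a x Ha Hx) as [_ H]. unfold ober_var.
  assert (H1 : (0 < a / ober a x)%R) by (apply Rdiv_lt_0_compat; lra).
  assert (H2 : (a / ober a x < 1)%R) by (apply Rlt_div_l; lra).
  lra.
Qed.

Lemma ober_ober_var (a x : R) :
  (0 < a)%R -> (0 < x)%R -> ober a x = (a * / (1 - ober_var a x))%R.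
Proof.
  intros Ha Hx. destruct (ober_gt a x Ha Hx) as [_ H]. unfold ober_var. field. lra.
Qed.

Lemma ober_root (a x : R) :
  (0 < a)%R -> (0 < x)%R ->
  (0 < sqrt (x ^ 2 + 2 * a * x) /\
   sqrt (x ^ 2 + 2 * a * x) * sqrt (x ^ 2 + 2 * a * x) = x ^ 2 + 2 * a * x)%R.
Proof. intros Ha Hx. split; [apply sqrt_lt_R0; nra | apply sqrt_sqrt; nra]. Qed.

Lemma x_ober_var (a x : R) :
  (0 < a)%R -> (0 < x)%R ->
  x = (a * / 2 * (ober_var a x * ober_var a x) * / (1 - ober_var a x))%R.
Proof.
  intros Ha Hx. destruct (ober_gt a x Ha Hx) as [_ H].
  destruct (ober_root a x Ha Hx) as [Hr Hr2].
  unfold ober_var.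
  transitivity ((ober a x - a) ^ 2 / (2 * ober a x))%R; [|field; lra].
  assert (Ew : ober a x = (x + a + sqrt (x ^ 2 + 2 * a * x))%R) by reflexivity.
  set (w := ober a x) in *. set (r := sqrt (x ^ 2 + 2 * a * x)) in *.
  apply (Rmult_eq_reg_r (2 * w)); [|lra].
  replace ((w - a) ^ 2 / (2 * w) * (2 * w))%R with ((w - a) ^ 2)%R by (field; lra).
  rewrite Ew.
  replace ((x + a + r - a) ^ 2)%R with (x ^ 2 + 2 * x * r + r * r)%R by ring.
  rewrite Hr2. ring.
Qed.

Definition ober_var' (a x : R) : R :=
  (a / (ober a x * sqrt (x ^ 2 + 2 * a * x)))%R.

Lemma is_derive_ober_var (a x : R) :
  (0 < a)%R -> (0 < x)%R -> is_derive (ober_var a) x (ober_var' a x).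
Proof.
  intros Ha Hx. destruct (ober_gt a x Ha Hx) as [_ H].
  destruct (ober_root a x Ha Hx) as [Hr _].
  unfold ober_var, ober_var', ober in *. auto_derive.
  - repeat split; [nra | simpl in *; lra].
  - simpl in *. field. split; lra.
Qed.

Lemma continuous_ober_var' (a x : R) :
  (0 < a)%R -> (0 < x)%R -> continuous (ober_var' a) x.
Proof.
  intros Ha Hx. destruct (ober_gt a x Ha Hx) as [_ H].
  destruct (ober_root a x Ha Hx) as [Hr _].
  apply (ex_derive_continuous (V := R_NormedModule)).
  unfold ober_var', ober in *. auto_derive. simpl in *.
  repeat split; try nra.
Qed.

Lemma ober_var'_eq (a x : R) :
  (0 < a)%R -> (0 < x)%R ->
  ober_var' a x = (2 * (1 - ober_var a x) ^ 2 /
    (a * ober_var a x * (1 + (1 - ober_var a x))))%R.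
Proof.
  intros Ha Hx. destruct (ober_gt a x Ha Hx) as [_ H].
  destruct (ober_root a x Ha Hx) as [Hr Hr2].
  assert (Hp := ober_var_bounds a x Ha Hx).
  unfold ober_var', ober_var in *.
  assert (Ew : ober a x = (x + a + sqrt (x ^ 2 + 2 * a * x))%R) by reflexivity.
  set (w := ober a x) in *. set (r := sqrt (x ^ 2 + 2 * a * x)) in *.
  assert (E : (2 * w * r = w ^ 2 - a ^ 2)%R) by (rewrite Ew; nra).
  assert (Hwa : (0 < w ^ 2 - a ^ 2)%R) by nra.
  replace (a / (w * r))%R with (2 * a / (2 * w * r))%R by (field; lra).
  rewrite E. field. nra.
Qed.

Lemma ober_var_at_right_0 (a : R) :
  (0 < a)%R -> filterlim (ober_var a) (at_right 0) (at_right 0).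
Proof.
  intros Ha P [d Hd].
  assert (He : (0 < a * d ^ 2 / 2)%R).
  { apply Rdiv_lt_0_compat; [|lra]. apply Rmult_lt_0_compat; [lra|].
    apply pow_lt, d. }
  exists (mkposreal _ He). intros x B Hx. change (Rabs (x - 0) < a * d ^ 2 / 2)%R in B.
  rewrite Rminus_0_r, Rabs_pos_eq in B by lra.
  assert (Hp := ober_var_bounds a x Ha Hx). assert (E := x_ober_var a x Ha Hx).
  set (p := ober_var a x) in *.
  apply Hd; [|lra]. change (Rabs (p - 0) < d)%R.
  rewrite Rminus_0_r, Rabs_pos_eq by lra.
  assert (L : (a * / 2 * (p * p) <= x)%R).
  { rewrite E at 1. rewrite <- (Rmult_1_r (a * / 2 * (p * p))) at 1.
    apply Rmult_le_compat_l; [nra|].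
    rewrite <- Rinv_1. apply Rinv_le_contravar; lra. }
  assert (Hd0 := cond_pos d).
  assert (p * p < d * d)%R by nra. nra.
Qed.

Lemma ober_var_p_infty (a : R) :
  (0 < a)%R -> filterlim (ober_var a) (Rbar_locally p_infty) (at_left 1).
Proof.
  intros Ha P [d Hd]. assert (Hd0 := cond_pos d).
  exists (a / d)%R. intros x Hx.
  assert (H0 : (0 < a / d)%R) by now apply Rdiv_lt_0_compat.
  assert (Hx0 : (0 < x)%R) by lra.
  assert (Hp := ober_var_bounds a x Ha Hx0).
  destruct (ober_gt a x Ha Hx0) as [H1 H2].
  apply Hd; [|lra]. change (Rabs (ober_var a x - 1) < d)%R.
  rewrite Rabs_left by lra. unfold ober_var.
  apply Rlt_div_l in Hx; trivial.
  replace (- (1 - a / ober a x - 1))%R with (a / ober a x)%R by ring.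
  apply Rlt_div_l; [lra|]. nra.
Qed.

Lemma ober_integrand_eq (a p x : R) (mu lam : C) :
  (0 < a)%R -> (0 < p < 1)%R -> x = (a * / 2 * (p * p) * / (1 - p))%R ->
  RtoC (2 * (1 - p) ^ 2 / (a * p * (1 + (1 - p)))) *
    (rcpow (a * / 2) mu * rcpow a (- lam) *
     (rcpow p (2 * mu - 1) * rcpow (1 - p) (lam - mu - 1) +
      rcpow p (2 * mu - 1) * rcpow (1 - p) (lam - mu + 1 - 1))) =
  rcpow x (mu - 1) * rcpow (a * / (1 - p)) (- lam).
Proof.
  intros Ha Hp ->. set (u := (1 - p)%R).
  assert (Hu : (0 < u)%R) by (unfold u; lra).
  assert (Hui : (0 < / u)%R) by now apply Rinv_0_lt_compat.
  assert (Hh : (0 < a * / 2)%R) by lra.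
  assert (Hpp : (0 < p * p)%R) by nra.
  assert (Hhp : (0 < a * / 2 * (p * p))%R) by now apply Rmult_lt_0_compat.
  rewrite (rcpow_mult_l (a * / 2 * (p * p))), (rcpow_mult_l (a * / 2) (p * p)),
    (rcpow_mult_l p p), (rcpow_mult_l a (/ u)), !rcpow_inv_l by lra.
  rewrite (rcpow_sub_1 (a * / 2) mu) by lra.
  replace (rcpow p (2 * mu - 1)) with (rcpow p (mu - 1) * rcpow p (mu - 1) * p).
  2: { rewrite <- (rcpow_1_r p) by lra. rewrite <- !rcpow_plus. f_equal. ring. }
  rewrite (rcpow_sub_1 u (lam - mu + 1 - 1)) by lra.
  replace (lam - mu + 1 - 1 - 1) with (lam - mu - 1) by ring.
  replace (rcpow u (- (mu - 1))) with
    (rcpow u (lam - mu - 1) * rcpow u (- lam) * (RtoC u * RtoC u)).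
  2: { rewrite <- (rcpow_1_r u) by lra. rewrite <- !rcpow_plus. f_equal. ring. }
  replace (rcpow u (- - lam)) with (/ rcpow u (- lam)) by (symmetry; apply rcpow_opp).
  assert (N := rcpow_neq_0 u (- lam)).
  set (P := rcpow p (mu - 1)). set (A := rcpow (a * / 2) (mu - 1)).
  replace (RtoC (2 * u ^ 2 / (a * p * (1 + u)))) with
    (2 * (RtoC u * RtoC u) * / (RtoC a * RtoC p * (1 + RtoC u))).
  2: { rewrite <- RtoC_plus, <- !RtoC_mult, <- RtoC_inv, <- RtoC_mult by nra.
       f_equal. simpl. field. lra. }
  rewrite RtoC_mult, RtoC_inv by lra.
  field. repeat split; trivial; try (apply RtoC_neq_0; lra).
  rewrite <- RtoC_plus. apply RtoC_neq_0; lra.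
Qed.

(** The substitution [t = ober_var a x] turns the integrand into
    [t ^ (2 mu - 1) (1 - t) ^ (lam - mu - 1) (2 - t)] up to a constant, and
    [2 - t = 1 + (1 - t)] splits it into two Beta integrands. *)
Theorem is_CInt_gen_ober (a : R) (mu lam : C) :
  (0 < a)%R -> (0 < Re mu)%R -> (Re mu < Re lam)%R ->
  is_CInt_gen (fun x => rcpow x (mu - 1) * rcpow (ober a x) (- lam))
    (at_right 0) (Rbar_locally p_infty)
    (2 * lam * rcpow a (- lam) * rcpow (a * / 2) mu
     * (Gamma (2 * mu) * Gamma (lam - mu) * rGamma (1 + lam + mu))).
Proof.
  intros Ha Hmu Hlam.
  assert (H2mu : (0 < Re (2 * mu))%R).
  { simpl. rewrite Rmult_0_l, Rminus_0_r. unfold Re in *. lra. }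
  assert (Hd : (0 < Re (lam - mu))%R) by (simpl; unfold Re in *; lra).
  assert (Hd1 : (0 < Re (lam - mu + 1))%R) by (simpl; unfold Re in *; lra).
  assert (B1 := is_Beta_Gamma (2 * mu) (lam - mu) H2mu Hd).
  assert (B2 := is_Beta_Gamma (2 * mu) (lam - mu + 1) H2mu Hd1).
  set (c := rcpow (a * / 2) mu * rcpow a (- lam)).
  set (f := fun t => c * (beta_integrand (2 * mu) (lam - mu) t
    + beta_integrand (2 * mu) (lam - mu + 1) t)).
  assert (Hf := is_CInt_gen_mult_l c _ _ _ _ (is_CInt_gen_plus _ _ _ _ _ _ B1 B2)).
  fold f in Hf.
  assert (Cf : forall t, (0 < t < 1)%R -> Ccontinuous f t).
  { intros t Ht. apply Ccontinuous_mult; [apply Ccontinuous_const|].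
    apply Ccontinuous_plus; now apply Ccontinuous_beta_integrand. }
  assert (Hcomp := is_CInt_gen_comp _ _ _ _ _ _ f (ober_var a) (ober_var' a) _
    half_line_ends unit_interval_ends
    (fun x Hx => ober_var_bounds a x Ha Hx) Cf
    (fun x Hx => is_derive_ober_var a x Ha Hx)
    (fun x Hx => continuous_ober_var' a x Ha Hx)
    (ober_var_at_right_0 a Ha) (ober_var_p_infty a Ha) Hf).
  match type of Hcomp with is_RInt_gen _ _ _ ?l => set (lv := l) in Hcomp end.
  match goal with |- is_RInt_gen _ _ _ ?l => replace l with lv end.
  - refine (is_CInt_gen_ext _ _ _ _ _ _ half_line_ends _ Hcomp).
    intros x Hx. unfold f, c, beta_integrand.
    assert (Hp := ober_var_bounds a x Ha Hx).
    rewrite (ober_var'_eq a x Ha Hx), (ober_ober_var a x Ha Hx).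
    exact (ober_integrand_eq a (ober_var a x) x mu lam Ha Hp (x_ober_var a x Ha Hx)).
  - unfold lv, c.
    replace (2 * mu + (lam - mu)) with (lam + mu) by ring.
    replace (2 * mu + (lam - mu + 1)) with (lam + mu + 1) by ring.
    replace (1 + lam + mu) with (lam + mu + 1) by ring.
    rewrite (Gamma_recurrence (lam - mu)), (rGamma_recurrence (lam + mu)).
    + ring.
    + intros E. rewrite E in Hd. simpl in Hd. lra.
    + now apply rGamma_neq_0_Re.
Qed.

(** * Complex series *)

Notation is_Cseries := (is_series (V := C_R_NormedModule)).
Notation ex_Cseries := (ex_series (V := C_R_NormedModule)).

Definition Csum_n (a : nat -> C) (n : nat) : C := sum_n (G := C_R_NormedModule) a n.

Lemma Csum_n_O (a : nat -> C) : Csum_n a O = a O.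
Proof. exact (sum_O (G := C_R_NormedModule) a). Qed.

Lemma Csum_n_S (a : nat -> C) (n : nat) : Csum_n a (S n) = Csum_n a n + a (S n).
Proof. exact (sum_Sn (G := C_R_NormedModule) a n). Qed.

Lemma Re_Csum_n (a : nat -> C) (n : nat) :
  Re (Csum_n a n) = sum_n (fun k => Re (a k)) n.
Proof.
  induction n as [|n IH]; [now rewrite sum_O, Csum_n_O|].
  rewrite Csum_n_S, sum_Sn, <- IH. reflexivity.
Qed.

Lemma Im_Csum_n (a : nat -> C) (n : nat) :
  Im (Csum_n a n) = sum_n (fun k => Im (a k)) n.
Proof.
  induction n as [|n IH]; [now rewrite sum_O, Csum_n_O|].
  rewrite Csum_n_S, sum_Sn, <- IH. reflexivity.
Qed.

Lemma is_Cseries_Ccv (a : nat -> C) (l : C) : is_Cseries a l <-> Ccv (Csum_n a) l.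
Proof. symmetry. apply Ccv_filterlim. Qed.

Lemma CSeries_unique (a : nat -> C) (l : C) : is_Cseries a l -> CSeries a = l.
Proof.
  intros H. apply is_Cseries_Ccv, Ccv_Re_Im in H as [H1 H2].
  unfold CSeries. rewrite (surjective_pairing l). f_equal; apply is_series_unique.
  - apply is_lim_seq_ext with (2 := H1). apply Re_Csum_n.
  - apply is_lim_seq_ext with (2 := H2). apply Im_Csum_n.
Qed.

Lemma CSeries_correct (a : nat -> C) : ex_Cseries a -> is_Cseries a (CSeries a).
Proof. intros [l Hl]. now rewrite (CSeries_unique a l Hl). Qed.

Lemma Csum_n_mult_l (c : C) (a : nat -> C) (n : nat) :
  Csum_n (fun k => c * a k) n = c * Csum_n a n.
Proof.
  induction n as [|n IH]; [now rewrite !Csum_n_O|].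
  rewrite !Csum_n_S, IH. ring.
Qed.

Lemma is_Cseries_mult_l (c : C) (a : nat -> C) (l : C) :
  is_Cseries a l -> is_Cseries (fun n => c * a n) (c * l).
Proof.
  intros H. apply is_Cseries_Ccv. apply is_Cseries_Ccv in H.
  apply Ccv_ext with (fun n => c * Csum_n a n).
  - intros n. symmetry. apply Csum_n_mult_l.
  - apply Ccv_mult; [apply Ccv_const | exact H].
Qed.

Lemma Cmod_CSeries_tail (a : nat -> C) (b : nat -> R) (N : nat) :
  (forall n, (Cmod (a n) <= b n)%R) -> ex_series b ->
  (Cmod (CSeries a - Csum_n a N) <= Series b - sum_n b N)%R.
Proof.
  intros H Hb.
  assert (Ha : ex_Cseries a) by now apply ex_series_C with b.
  apply (is_lim_seq_le_loc (fun m => Cmod (Csum_n a m - Csum_n a N))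
    (fun m => sum_n b m - sum_n b N)%R (Cmod (CSeries a - Csum_n a N))
    (Series b - sum_n b N)%R).
  - exists N. intros m Hm. induction Hm as [|m Hm IH].
    + replace (Csum_n a N - Csum_n a N) with (RtoC 0) by ring. rewrite Cmod_0. lra.
    + rewrite Csum_n_S, sum_Sn. unfold plus; simpl (AbelianMonoid.plus _ _).
      replace (Csum_n a m + a (S m) - Csum_n a N)
        with ((Csum_n a m - Csum_n a N) + a (S m)) by ring.
      eapply Rle_trans; [apply Cmod_triangle|]. specialize (H (S m)). simpl. lra.
  - apply (Ccv_Cmod (fun m => Csum_n a m - Csum_n a N)).
    apply (Ccv_plus (Csum_n a) (fun _ => - Csum_n a N)); [|apply Ccv_const].
    now apply is_Cseries_Ccv, CSeries_correct.
  - apply is_lim_seq_minus'; [|apply is_lim_seq_const].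
    now apply Series_correct.
Qed.

(** Absolute convergence everywhere makes the radius of convergence infinite. *)
Lemma PSeries_continuous_entire (a : nat -> R) (x : R) :
  (forall r, (0 <= r)%R -> ex_series (fun n => Rabs (a n) * r ^ n)%R) ->
  continuous (PSeries a) x.
Proof.
  intros H. apply continuity_pt_filterlim, PSeries_continuity.
  apply Rbar_lt_le_trans with (Rabs x + 1)%R; [simpl; lra|].
  apply (proj1 (Lub_Rbar_correct (CV_disk a))). unfold CV_disk.
  apply ex_series_ext with (fun n => Rabs (a n) * (Rabs x + 1) ^ n)%R.
  - intros n. assert (P := Rabs_pos x).
    rewrite Rabs_mult, <- RPow_abs, (Rabs_pos_eq (Rabs x + 1)) by lra. reflexivity.
  - apply H. assert (P := Rabs_pos x). lra.
Qed.

(** As [rho] is real, the real and imaginary parts of the sum are real power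
    series in [rho t]. *)
Lemma Ccontinuous_CSeries (e : nat -> C) (rho : R -> R) (x : R) :
  (forall r, (0 <= r)%R -> ex_series (fun n => Cmod (e n) * r ^ n)%R) ->
  continuous rho x ->
  Ccontinuous (fun t => CSeries (fun n => e n * RtoC (rho t) ^ n)) x.
Proof.
  intros H Hrho.
  assert (B : forall g : C -> R, (forall z, (Rabs (g z) <= Cmod z)%R) ->
    continuous (fun t => PSeries (fun n => g (e n)) (rho t)) x).
  { intros g Hg. apply (continuous_comp rho (PSeries (fun n => g (e n)))); trivial.
    apply PSeries_continuous_entire. intros r Hr.
    apply (ex_series_le (V := R_CompleteNormedModule) _ (fun n => Cmod (e n) * r ^ n)%R).
    - intros n. unfold norm; simpl norm. unfold abs; simpl abs.
      rewrite Rabs_pos_eq by (apply Rmult_le_pos; [apply Rabs_pos | now apply pow_le]).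
      apply Rmult_le_compat_r; [now apply pow_le | apply Hg].
    - now apply H. }
  assert (E : forall (t : R) (n : nat), e n * RtoC t ^ n =
    (Re (e n) * t ^ n, Im (e n) * t ^ n)%R).
  { intros t n. rewrite <- RtoC_pow. destruct (e n).
    unfold RtoC, Cmult, Re, Im; simpl. f_equal; ring. }
  split.
  - apply (continuous_ext (fun t => PSeries (fun n => Re (e n)) (rho t)));
      [|apply B, re_le_Cmod].
    intros t. change (Re (CSeries ?u)) with (Series (fun n => Re (u n))).
    apply Series_ext. intros n. now rewrite E.
  - apply (continuous_ext (fun t => PSeries (fun n => Im (e n)) (rho t)));
      [|apply B, im_le_Cmod].
    intros t. change (Im (CSeries ?u)) with (Series (fun n => Im (u n))).
    apply Series_ext. intros n. now rewrite E.
Qed.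

(** * Termwise integration *)

Lemma is_CInt_gen_Csum_n (D : R -> Prop) (Fa Fb : (R -> Prop) -> Prop)
  (phi : nat -> R -> C) (e I : nat -> C) (N : nat) :
  interval_ends D Fa Fb -> (forall n, is_CInt_gen (phi n) Fa Fb (I n)) ->
  is_CInt_gen (fun x => Csum_n (fun n => e n * phi n x) N) Fa Fb
    (Csum_n (fun n => e n * I n) N).
Proof.
  intros E H.
  assert (FFa := ends_lower _ _ _ E). assert (FFb := ends_upper _ _ _ E).
  induction N as [|N IH].
  - rewrite Csum_n_O. refine (is_CInt_gen_ext D _ _ _ _ _ E _
      (is_CInt_gen_mult_l (e O) _ _ _ _ (H O))).
    intros x _. now rewrite Csum_n_O.
  - rewrite Csum_n_S. refine (is_CInt_gen_ext D _ _ _ _ _ E _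
      (is_CInt_gen_plus _ _ _ _ _ _ IH (is_CInt_gen_mult_l (e (S N)) _ _ _ _ (H (S N))))).
    intros x _. now rewrite Csum_n_S.
Qed.

(** The power series converges uniformly on the range [[0, r]] of [rho], and its
    factor [G] is absolutely integrable: a remainder bounded by [tau]
    contributes at most [tau] times the integral of [|G|]. *)
Theorem is_CInt_gen_termwise (D : R -> Prop) (Fa Fb : (R -> Prop) -> Prop)
  (G : R -> C) (rho : R -> R) (r M : R) (e I : nat -> C) :
  interval_ends D Fa Fb -> (0 <= r)%R ->
  (forall x, D x -> Ccontinuous G x) -> (forall x, D x -> continuous rho x) ->
  (forall x, D x -> (0 <= rho x <= r)%R) ->
  (forall s, (0 <= s)%R -> ex_series (fun n => Cmod (e n) * s ^ n)%R) ->
  (forall n, is_CInt_gen (fun x => G x * RtoC (rho x) ^ n) Fa Fb (I n)) ->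
  is_RInt_gen (fun x => Cmod (G x)) Fa Fb M ->
  ex_Cseries (fun n => e n * I n) /\
  is_CInt_gen (fun x => G x * CSeries (fun n => e n * RtoC (rho x) ^ n)) Fa Fb
    (CSeries (fun n => e n * I n)).
Proof.
  intros E Hr HG Hrho Hb He HI HM.
  assert (FFa := ends_lower _ _ _ E). assert (FFb := ends_upper _ _ _ E).
  set (b := fun n => (Cmod (e n) * r ^ n)%R).
  assert (Hbs : ex_series b) by now apply He.
  assert (Hpow : forall x n, D x -> (Cmod (RtoC (rho x) ^ n) <= r ^ n)%R).
  { intros x n Dx. rewrite Cmod_pow, Cmod_RtoC_pos by now apply Hb.
    apply pow_incr. now apply Hb. }
  assert (HIb : forall n, (Cmod (e n * I n) <= M * b n)%R).
  { intros n. rewrite Cmod_mult. unfold b.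
    replace (M * (Cmod (e n) * r ^ n))%R with (Cmod (e n) * (r ^ n * M))%R by ring.
    apply Rmult_le_compat_l; [apply Cmod_ge_0|].
    refine (Cmod_CInt_gen_le D Fa Fb _ _ _ _ E _ (HI n)
      (is_RInt_gen_scal (V := R_NormedModule) _ (r ^ n) _ HM)).
    intros x Dx. rewrite Cmod_mult. unfold scal; simpl; unfold mult; simpl.
    rewrite Rmult_comm. apply Rmult_le_compat_r; [apply Cmod_ge_0 | now apply Hpow]. }
  assert (HMb : ex_series (fun n => M * b n)%R)
    by now apply (ex_series_scal (V := R_NormedModule)).
  split; [now apply ex_series_C with (2 := HMb)|].
  set (S := fun x => CSeries (fun n => e n * RtoC (rho x) ^ n)).
  set (A := CSeries (fun n => e n * I n)).
  apply (proj2 (is_CInt_gen_eps _ _ _ _)). intros eps.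
  (* The three errors are below [tau (|M| + 1)], [eps / 2] and [tau |M|], where
     [tau < d] is the remainder of the dominating series. *)
  set (d := (eps / (2 * (2 * Rabs M + 2)))%R).
  assert (HM0 := Rabs_pos M).
  assert (Hd : (0 < d)%R).
  { apply Rdiv_lt_0_compat; [apply eps | lra]. }
  assert (Htau : exists N, (Rabs (Series b - sum_n b N) < d)%R).
  { assert (H := Series_correct _ Hbs).
    apply (is_lim_seq_spec (sum_n b) (Series b)) in H.
    destruct (H (mkposreal d Hd)) as [N HN]. exists N.
    rewrite Rabs_minus_sym. apply (HN N (le_n N)). }
  destruct Htau as [N HN]. set (tau := (Series b - sum_n b N)%R) in *.
  assert (Htau0 : (0 <= tau)%R).
  { eapply Rle_trans; [apply Cmod_ge_0|].
    apply (Cmod_CSeries_tail (fun n => RtoC (b n)) b N); trivial.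
    intros n. rewrite Cmod_RtoC_pos; [lra|].
    apply Rmult_le_pos; [apply Cmod_ge_0 | now apply pow_le]. }
  rewrite Rabs_pos_eq in HN by trivial.
  set (SN := fun x => Csum_n (fun n => e n * (G x * RtoC (rho x) ^ n)) N).
  set (AN := Csum_n (fun n => e n * I n) N).
  assert (H1 : is_CInt_gen SN Fa Fb AN).
  { apply (is_CInt_gen_Csum_n D Fa Fb (fun n x => G x * RtoC (rho x) ^ n)); trivial. }
  assert (HAN : (Cmod (A - AN) <= Rabs M * tau)%R).
  { unfold A, AN. eapply Rle_trans.
    { apply (Cmod_CSeries_tail _ _ N HIb HMb). }
    rewrite Series_scal_l.
    replace (sum_n (fun n => M * b n)%R N) with (M * sum_n b N)%R.
    2: { symmetry. apply (sum_n_mult_l (K := R_AbsRing) M b N). }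
    rewrite <- Rmult_minus_distr_l. fold tau.
    apply Rmult_le_compat_r; [trivial | apply Rle_abs]. }
  assert (HSN : forall x, D x -> (Cmod (G x * S x - SN x) <= tau * Cmod (G x))%R).
  { intros x Dx. unfold SN, S.
    replace (Csum_n (fun n => e n * (G x * RtoC (rho x) ^ n)) N)
      with (G x * Csum_n (fun n => e n * RtoC (rho x) ^ n) N).
    2: { rewrite <- Csum_n_mult_l. apply (sum_n_ext (G := C_R_NormedModule)).
         intros n. match goal with |- ?x = ?y => change (@eq C x y) end. ring. }
    match goal with |- (Cmod ?z <= _)%R => replace z with
      ((CSeries (fun n => e n * RtoC (rho x) ^ n)
        - Csum_n (fun n => e n * RtoC (rho x) ^ n) N) * G x) by ring end.
    rewrite Cmod_mult. apply Rmult_le_compat_r; [apply Cmod_ge_0|].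
    apply Cmod_CSeries_tail; trivial. intros n. rewrite Cmod_mult. unfold b.
    apply Rmult_le_compat_l; [apply Cmod_ge_0 | now apply Hpow]. }
  assert (He2 : (0 < eps / 2)%R) by (destruct eps; simpl; lra).
  assert (K1 := proj1 (is_CInt_gen_eps _ _ _ _) H1 (mkposreal _ He2)).
  assert (K2 := HM _ (locally_ball (M : R_NormedModule) (mkposreal 1 Rlt_0_1))).
  unfold filtermapi in K2.
  generalize (filter_and _ _ (filter_and _ _ K1 K2) (ends_prod _ _ _ E)).
  apply filter_imp.
  intros [s t] [[[J [HJ HJe]] [Q [HQ HQe]]] [Ds [Dt Hst]]]; simpl in *.
  change (Rabs (Q - M) < 1)%R in HQe.
  assert (In : forall x, (s <= x <= t)%R -> D x).
  { intros x Hx. now apply (ends_convex _ _ _ E s t). }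
  destruct (ex_CInt_continuous (fun x => G x * S x) s t) as [Z HZ].
  { intros x Hx. rewrite Rmin_left, Rmax_right in Hx by trivial. apply In in Hx.
    apply Ccontinuous_mult; [now apply HG|].
    apply Ccontinuous_CSeries; [trivial | now apply Hrho]. }
  exists Z. split; [exact HZ|].
  assert (HZJ : (Cmod (Z - J) <= tau * Q)%R).
  { refine (Cmod_CInt_le (fun x => G x * S x - SN x) (fun x => tau * Cmod (G x))%R
      s t _ _ Hst _ _ _).
    - intros x Hx. now apply HSN, In.
    - apply (is_RInt_minus (V := C_R_NormedModule)); assumption.
    - apply (is_RInt_scal (V := R_NormedModule)); exact HQ. }
  replace (Z - A) with ((Z - J) + (J - AN) + - (A - AN)) by ring.
  eapply Rle_lt_trans; [apply Cmod_triangle|]. rewrite Cmod_opp.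
  assert (T := Cmod_triangle (Z - J) (J - AN)).
  assert (HQM : (tau * Q <= tau * (Rabs M + 1))%R).
  { apply Rmult_le_compat_l; trivial. apply Rabs_def2 in HQe.
    assert (P := Rle_abs M). lra. }
  assert (Hfin : (tau * (2 * Rabs M + 2) < eps / 2)%R).
  { apply Rlt_le_trans with (d * (2 * Rabs M + 2))%R.
    - apply Rmult_lt_compat_r; lra.
    - apply Req_le. unfold d. field. lra. }
  nra.
Qed.

(** * The Bessel-Maitland integral *)

Lemma pochhammer_Gamma (g : C) (t : R) :
  Gamma g <> 0 -> pochhammer g t = Gamma (g + t) / Gamma g.
Proof.
  intros H. unfold pochhammer. destruct (Req_EM_T t 0) as [->|]; trivial.
  replace (g + 0) with g by ring. field. exact H.
Qed.

Lemma not_pole_Re_nonneg (z : C) (k : nat) :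
  (0 <= Re z)%R -> z <> 0 -> z + INR k <> 0.
Proof.
  intros H H0 E. destruct k as [|k].
  - apply H0. rewrite <- E. simpl. ring.
  - apply (f_equal Re) in E. change (Re z + INR (S k) = 0)%R in E.
    rewrite S_INR in E. assert (P := pos_INR k). lra.
Qed.

Lemma Gamma_neq_0 (z : C) : (forall k : nat, z + INR k <> 0) -> Gamma z <> 0.
Proof. intros H. now apply Cinv_neq_0, rGamma_neq_0. Qed.

Lemma continuous_ober (a x : R) :
  (0 < a)%R -> (0 < x)%R -> continuous (ober a) x.
Proof.
  intros Ha Hx. apply (ex_derive_continuous (V := R_NormedModule)).
  unfold ober. auto_derive. simpl. repeat split; nra.
Qed.

Lemma Ccontinuous_rcpow_ober (a x : R) (s : C) :
  (0 < a)%R -> (0 < x)%R -> Ccontinuous (fun t => rcpow (ober a t) s) x.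
Proof.
  intros Ha Hx. destruct (ober_gt a x Ha Hx) as [_ H].
  destruct (Ccontinuous_rcpow s (ober a x)) as [P1 P2]; [lra|].
  split.
  - apply (continuous_comp (ober a) (fun u => Re (rcpow u s))); trivial.
    now apply continuous_ober.
  - apply (continuous_comp (ober a) (fun u => Im (rcpow u s))); trivial.
    now apply continuous_ober.
Qed.

(** The left-hand side is the integral of the [n]-th term. The identity rests on
    [lam + n = Gamma (lam + n + 1) / Gamma (lam + n)] and
    [2 a ^ (- lam - n) (a / 2) ^ (mu + n) = 2 ^ (1 - mu) a ^ (mu - lam) 2 ^ (- n)]. *)
Lemma wright_term_bessel_maitland
  (a q : R) (y delta lam mu v gam : C) (n : nat) :
  (0 < a)%R -> (0 < Re mu)%R -> (Re mu < Re lam)%R -> Gamma gam <> 0 ->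
  bessel_maitland_coeff delta gam v q n * y ^ n
  * (2 * (lam + INR n) * rcpow a (- (lam + INR n)) * rcpow (a * / 2) (mu + INR n)
     * (Gamma (2 * (mu + INR n)) * Gamma (lam + INR n - (mu + INR n))
        * rGamma (1 + (lam + INR n) + (mu + INR n))))
  = rcpow 2 (1 - mu) * rcpow a (mu - lam) * (Gamma (lam - mu) / Gamma gam)
    * wright_term [(gam, RtoC q); (lam + 1, RtoC 1); (2 * mu, RtoC 2)]
        [(v + 1, delta); (1 + lam + mu, RtoC 2); (lam, RtoC 1)] (- y / 2) n.
Proof.
  intros Ha Hmu Hlam Hg.
  unfold bessel_maitland_coeff, wright_term. cbn [map fst snd Cprod fold_right].
  rewrite pochhammer_Gamma, RtoC_mult by trivial.
  replace (lam + 1 + 1 * INR n) with (lam + INR n + 1) by ring.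
  replace (lam + 1 * INR n) with (lam + INR n) by ring.
  replace (2 * (mu + INR n)) with (2 * mu + 2 * INR n) by ring.
  replace (lam + INR n - (mu + INR n)) with (lam - mu) by ring.
  replace (1 + (lam + INR n) + (mu + INR n)) with (1 + lam + mu + 2 * INR n) by ring.
  replace (delta * INR n + v + 1) with (v + 1 + delta * INR n) by ring.
  assert (N1 : rGamma (lam + INR n + 1) <> 0).
  { apply rGamma_neq_0_Re. change (0 < Re lam + INR n + 1)%R.
    assert (P := pos_INR n). lra. }
  rewrite (rGamma_recurrence (lam + INR n)). 
  change (Gamma (lam + INR n + 1)) with (/ rGamma (lam + INR n + 1)).
  replace (- y / 2) with (- (1) * (y * / 2)) by (unfold Cdiv; ring).
  rewrite !Cpow_mult_l, Cpow_inv by (apply RtoC_neq_0; lra).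
  assert (N2 : RtoC 2 ^ n <> 0) by (apply Cpow_nz, RtoC_neq_0; lra).
  assert (N3 := INR_fact_neq_0_C n).
  assert (E : rcpow a (- (lam + INR n)) * rcpow (a * / 2) (mu + INR n) =
    rcpow 2 (1 - mu) * rcpow a (mu - lam) * / 2 * / 2 ^ n).
  { rewrite rcpow_mult_l, rcpow_inv_l by lra.
    rewrite <- (rcpow_INR 2 n) by lra. rewrite <- (rcpow_1_r 2) by lra.
    rewrite <- !rcpow_opp.
    replace (mu - lam) with (- (lam + INR n) + (mu + INR n)) by ring.
    replace (- (mu + INR n)) with (1 - mu + - (1) + - INR n) by ring.
    rewrite !(rcpow_plus a), !(rcpow_plus 2). ring. }
  rewrite <- (Cmult_assoc (2 * (lam + INR n)) (rcpow a (- (lam + INR n)))).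
  rewrite E.
  field. repeat split; trivial.
Qed.

Theorem theorem2 (a q : R) (y delta lam mu v gam : C)
  (ha : (0 < a)%R)
  (hq : (0 < q < 1)%R \/ exists m : nat, (0 < m)%nat /\ q = INR m)
  (hdelta : (0 <= Re delta)%R)
  (hv : (-1 < Re v)%R)
  (hgam : (0 <= Re gam)%R)
  (hgam0 : gam <> 0)
  (hdq : (-1 < Re delta - q)%R)
  (hmu : (0 < Re mu)%R)
  (hlam : (Re mu < Re lam)%R) :
  let w := fun x : R => (x + a + sqrt (x ^ 2 + 2 * a * x))%R in
  let num := [(gam, RtoC q); (lam + 1, RtoC 1); (2 * mu, RtoC 2)] in
  let den := [(v + 1, delta); (1 + lam + mu, RtoC 2); (lam, RtoC 1)] in
  (forall x : R, (0 < x)%R ->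
     ex_series (V := C_R_NormedModule)
       (bessel_maitland_term delta gam v q (x * y / w x))) /\
  ex_series (V := C_R_NormedModule) (wright_term num den (- y / 2)) /\
  is_RInt_gen (V := C_R_NormedModule)
    (fun x : R =>
       rcpow x (mu - 1) * rcpow (w x) (- lam)
       * bessel_maitland delta gam v q (x * y / w x))
    (at_right 0) (Rbar_locally p_infty)
    (rcpow 2 (1 - mu) * rcpow a (mu - lam) * (Gamma (lam - mu) / Gamma gam)
     * wright num den (- y / 2)).
Proof.
  intros w num den.
  assert (Hq : (0 < q)%R).
  { destruct hq as [H|[m [Hm ->]]]; [lra | now apply lt_0_INR]. }
  assert (Hc := fun r => ex_series_bessel_maitland_coeff delta gam v q r
    hgam Hq hv hdelta hdq).
  assert (Hgam : Gamma gam <> 0).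
  { apply Gamma_neq_0. intros k. now apply not_pole_Re_nonneg. }
  assert (Hlm : Gamma (lam - mu) <> 0).
  { apply Gamma_neq_0. intros k. apply Re_pos_not_pole.
    change (0 < Re lam - Re mu)%R. lra. }
  split.
  { intros x _.
    apply ex_series_C with (fun n => Cmod (bessel_maitland_coeff delta gam v q n)
      * Cmod (x * y / w x) ^ n)%R; [|apply Hc, Cmod_ge_0].
    intros n. rewrite bessel_maitland_term_coeff, Cmod_mult, Cmod_pow. lra. }
  set (e := fun n => bessel_maitland_coeff delta gam v q n * y ^ n).
  set (G := fun x => rcpow x (mu - 1) * rcpow (ober a x) (- lam)).
  set (rho := fun x => (x / ober a x)%R).
  assert (Hrho : forall x, (0 < x)%R -> (0 <= rho x <= / 2)%R).
  { intros x Hx. destruct (ober_gt a x ha Hx) as [H1 H2]. unfold rho. split.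
    - apply Rlt_le, Rdiv_lt_0_compat; lra.
    - apply Rle_div_l; lra. }
  set (I := fun n : nat =>
    2 * (lam + INR n) * rcpow a (- (lam + INR n)) * rcpow (a * / 2) (mu + INR n)
     * (Gamma (2 * (mu + INR n)) * Gamma (lam + INR n - (mu + INR n))
        * rGamma (1 + (lam + INR n) + (mu + INR n)))).
  destruct (is_CInt_gen_termwise _ _ _ G rho (/ 2)
    (Re (2 * Re lam * rcpow a (- Re lam) * rcpow (a * / 2) (Re mu)
      * (Gamma (2 * Re mu) * Gamma (Re lam - Re mu) * rGamma (1 + Re lam + Re mu))))
    e I half_line_ends) as [Hs Hint].
  - lra.
  - intros x Hx. apply Ccontinuous_mult;
      [now apply Ccontinuous_rcpow | now apply Ccontinuous_rcpow_ober].
  - intros x Hx. destruct (ober_gt a x ha Hx) as [_ H].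
    apply (continuous_mult (K := R_AbsRing)); [apply continuous_id|].
    apply continuous_Rinv_comp; [now apply continuous_ober | lra].
  - exact Hrho.
  - intros s Hs. apply ex_series_ext with (fun n =>
      Cmod (bessel_maitland_coeff delta gam v q n) * (Cmod y * s) ^ n)%R.
    + intros n. unfold e. rewrite Cmod_mult, Cmod_pow, Rpow_mult_distr.
      symmetry. apply Rmult_assoc.
    + apply Hc, Rmult_le_pos; [apply Cmod_ge_0 | trivial].
  - intros n.
    refine (is_CInt_gen_ext _ _ _ _ _ _ half_line_ends _
      (is_CInt_gen_ober a (mu + INR n) (lam + INR n) ha _ _)).
    + intros x Hx. destruct (ober_gt a x ha Hx) as [H1 H2]. unfold G, rho.
      replace (mu + INR n - 1) with (mu - 1 + INR n) by ring.
      replace (- (lam + INR n)) with (- lam + - INR n) by ring.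
      rewrite !rcpow_plus, (rcpow_opp _ (INR n)), !rcpow_INR by lra.
      unfold Rdiv. rewrite RtoC_mult, RtoC_inv, Cpow_mult_l, Cpow_inv; try lra.
      * unfold G. ring.
      * apply RtoC_neq_0; lra.
    + change (0 < Re mu + INR n)%R. assert (P := pos_INR n). lra.
    + change (Re mu + INR n < Re lam + INR n)%R. lra.
  - (* The modulus of the integrand is the integrand at the real parts of [mu] and
       [lam]. *)
    assert (H := is_CInt_gen_ober a (Re mu) (Re lam) ha hmu hlam).
    apply is_CInt_gen_Re in H; try typeclasses eauto.
    apply (is_RInt_gen_ext (V := R_NormedModule)) with (2 := H).
    apply filter_forall. intros [s t] x _. unfold G.
    rewrite Cmod_mult, !Cmod_rcpow, <- RtoC_minus, <- RtoC_opp, !rcpow_RtoC, <- RtoC_mult.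
    reflexivity.
  - set (c := rcpow 2 (1 - mu) * rcpow a (mu - lam) * (Gamma (lam - mu) / Gamma gam)).
    assert (Hc0 : c <> 0).
    { unfold c, Cdiv. repeat apply Cmult_neq_0; trivial; try apply rcpow_neq_0.
      now apply Cinv_neq_0. }
    assert (HeI : forall n, e n * I n = c * wright_term num den (- y / 2) n).
    { intros n. now apply wright_term_bessel_maitland. }
    assert (Hw : is_Cseries (wright_term num den (- y / 2))
      (/ c * CSeries (fun n => e n * I n))).
    { apply (is_series_ext (V := C_R_NormedModule)) with (fun n => / c * (e n * I n)).
      - intros n. rewrite HeI.
        match goal with |- ?l = ?r => change (@eq C l r) end. field. trivial.
      - apply is_Cseries_mult_l, CSeries_correct, Hs. }
    split; [eexists; exact Hw|].
    unfold wright. rewrite (CSeries_unique _ _ Hw).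
    assert (Ec : c * (/ c * CSeries (fun n => e n * I n)) = CSeries (fun n => e n * I n))
      by (field; trivial).
    rewrite Ec.
    refine (is_CInt_gen_ext _ _ _ _ _ _ half_line_ends _ Hint).
    intros x Hx. unfold G. change (ober a x) with (w x). f_equal.
    unfold bessel_maitland, CSeries. destruct (ober_gt a x ha Hx) as [H1 H2].
    assert (T : forall n, e n * RtoC (rho x) ^ n
      = bessel_maitland_term delta gam v q (x * y / w x) n).
    { intros n. rewrite bessel_maitland_term_coeff. unfold e, rho, Rdiv.
      change (ober a x) with (w x) in *.
      rewrite RtoC_mult, RtoC_inv by lra. unfold Cdiv. rewrite !Cpow_mult_l. ring. }
    f_equal; apply Series_ext; intros n; now rewrite T.
Qed.
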